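(* For every positive integer $m$, there exist chiral $3$-polytopes $\mathcal{P}^1_m$, $\mathcal{P}^2_m$, $\mathcal{P}^3_m$ and $\mathcal{P}^4_m$, each of (Schläfli) type $\{4,8\}$, whose automorphism groups are solvable and have orders $1024m^4$, $2048m^4$, $4096m^4$ and $8192m^4$, respectively.
   Context: An (abstract) polytope of rank $n$, or $n$-polytope, is a partially ordered set $\mathcal{P}$ with a strictly monotone rank function with range $\{-1,0,\dots,n\}$ satisfying (P1)-(P4) below. Elements of $\mathcal{P}$ are called faces, and those of rank $j$ are called $j$-faces. Two faces $F,G$ are incident if $F\le G$ or $F\ge G$. Flags are the maximal chains. Two flags are $j$-adjacent if they differ in exactly one face, of rank $j$, and adjacent if they are $j$-adjacent for some $j$. For faces $F\le G$, the section $G/F$ is $\{H\in\mathcal{P} : F\le H\le G\}$; it has rank $\mathrm{rank}(G)-\mathrm{rank}(F)-1$. (P1) $\mathcal{P}$ has a least face $F_{-1}$ and a greatest face $F_n$. (P2) Every flag contains exactly $n+2$ faces (including $F_{-1}$ and $F_n$). (P3) (Strong flag-connectedness) Any two flags $\Phi,\Psi$ can be joined by a sequence of flags $\Phi=\Phi_0,\Phi_1,\dots,\Phi_k=\Psi$ in which consecutive flags are adjacent and every $\Phi_i$ contains $\Phi\cap\Psi$. (P4) (Diamond condition) If $F<G$ are faces of ranks $i-1$ and $i+1$, with $0\le i\le n-1$, then there are exactly two $i$-faces $H$ with $F<H<G$. Every section of rank $2$ is isomorphic to the face lattice of a polygon. $\mathcal{P}$ has (Schläfli) type $\{k_1,\dots,k_{n-1}\}$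 if, for each $i$ with $1\le i\le n-1$, every section $G/F$ with $F$ an $(i-2)$-face and $G$ an $(i+1)$-face incident with it is the face lattice of a $k_i$-gon. Thus for $n=3$, $k_1$ is the number of edges of each $2$-face and $k_2$ is the valency of each vertex. An automorphism of $\mathcal{P}$ is an order-preserving permutation of its elements (with order-preserving inverse); these form the automorphism group of $\mathcal{P}$. $\mathcal{P}$ is chiral if its automorphism group has exactly two orbits on flags, with any two adjacent flags lying in different orbits. *)

(* Defs.v *)
From HB Require Import structures.
From mathcomp Require Import all_boot all_order all_algebra all_fingroup all_solvable.

Set Implicit Arguments.
Unset Strict Implicit.
Unset Printing Implicit Defensive.

Import Order.TTheory GRing.Theory Num.Theory.
Local Open Scope order_scope.

Section Flags.
Variables (d : Order.disp_t) (T : finPOrderType d).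

Definition is_chain (C : {set T}) : bool :=
  [forall F in C, forall G in C, F >=< G].

Definition is_flag (Phi : {set T}) : bool := maxset is_chain Phi.

Definition j_adjacent (rk : T -> int) (j : int) (Phi Psi : {set T}) : bool :=
  [exists F in Phi, exists G in Psi,
    [&& F != G, rk F == j, rk G == j & Phi :\ F == Psi :\ G]].

(* Only ranks of faces are relevant, so j ranges over the values of rk. *)
Definition adjacent (rk : T -> int) (Phi Psi : {set T}) : bool :=
  [exists F, j_adjacent rk (rk F) Phi Psi].

Definition face_section (F G : T) : {set T} := [set H | F <= H <= G].

End Flags.

(* Finiteness of the set of faces is part of the definition.  For chiral
   polytopes it amounts to finiteness of the automorphism group: there are then
   two finite orbits of flags, and every face lies in a flag. *)
Record polytope (n : nat) := Polytope {
  face_disp : Order.disp_t;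
  face :> finPOrderType face_disp;
  rank : face -> int;
  rank_lt : forall F G : face, F < G -> (rank F < rank G)%R;
  rank_range : forall j : int,
    (exists F : face, rank F = j) <-> (-1 <= j <= n%:Z)%R;
  polytope_P1 : (exists Fmin : face, forall F : face, Fmin <= F) /\
                (exists Fmax : face, forall F : face, F <= Fmax);
  polytope_P2 : forall Phi : {set face}, is_flag Phi -> #|Phi| = n.+2;
  polytope_P3 : forall Phi Psi : {set face}, is_flag Phi -> is_flag Psi ->
    exists s : seq {set face},
      [/\ path (adjacent rank) Phi s, last Phi s = Psi &
          forall X, X \in s -> is_flag X /\ Phi :&: Psi \subset X];
  polytope_P4 : forall (i : nat) (F G : face), (i < n)%N -> F < G ->
    rank F = (i%:Z - 1)%R -> rank G = (i%:Z + 1)%R ->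
    #|[set H : face | (rank H == i%:Z%R) && (F < H < G)]| = 2%N
}.

Inductive polygon_face (k : nat) : Type :=
  | PolygonBottom
  | PolygonVertex of 'I_k
  | PolygonEdge of 'I_k
  | PolygonTop.

(* The face lattice of the k-gon (meaningful for k >= 2): edge j joins the
   vertices j and j + 1 mod k. *)
Definition polygon_le (k : nat) (x y : polygon_face k) : bool :=
  match x, y with
  | PolygonBottom, _ => true
  | _, PolygonTop => true
  | PolygonVertex i, PolygonVertex j => i == j
  | PolygonVertex i, PolygonEdge j => (i == j) || (i == ordS j)
  | PolygonEdge i, PolygonEdge j => i == j
  | _, _ => false
  end.

Definition polygonal_section d (T : finPOrderType d) (k : nat) (F G : T) : Prop :=
  exists f : polygon_face k -> T,
    [/\ injective f,
        forall H, H \in face_section F G <-> exists x, H = f x &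
        forall x y, (f x <= f y) = polygon_le x y].

(* The Schlaefli type {k_1, ..., k_(n-1)} is the list [:: k_1; ...; k_(n-1)]. *)
Definition has_type (n : nat) (P : polytope n) (ks : seq nat) : Prop :=
  size ks = n.-1 /\
  forall (i : nat) (F G : P), (1 <= i <= n.-1)%N ->
    rank F = (i%:Z - 2)%R -> rank G = (i%:Z + 1)%R -> F <= G ->
    polygonal_section (nth 0%N ks i.-1) F G.

Section Automorphisms.
Variables (n : nat) (P : polytope n).

Definition polytope_aut : {set {perm P}} :=
  [set s : {perm P} | [forall F, forall G, (s F <= s G) == (F <= G)]].

Lemma polytope_aut_group_set : group_set polytope_aut.
Proof.
apply/group_setP; split=> [|s t].
  by rewrite inE; apply/forallP=> F; apply/forallP=> G; rewrite !perm1.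
rewrite !inE => /forallP s_le /forallP t_le.
apply/forallP=> F; apply/forallP=> G; rewrite !permM.
by rewrite (eqP (forallP (t_le _) _)) (forallP (s_le _) _).
Qed.

Canonical polytope_aut_group := Group polytope_aut_group_set.

Definition flags : {set {set P}} := [set Phi | is_flag Phi].

(* 'P^* is the action of permutations of faces on sets of faces. *)
Definition chiral : Prop :=
  #|orbit 'P^* polytope_aut @: flags| = 2%N /\
  forall Phi Psi : {set P}, Phi \in flags -> Psi \in flags ->
    adjacent (@rank n P) Phi Psi -> Psi \notin orbit 'P^* polytope_aut Phi.

End Automorphisms.

(* Main.v *)
(* A finite group generated by x and y, with (x y)^2 = 1 and <x> meeting <y> trivially,
   yields a 3-polytope whose vertices, edges and 2-faces are the cosets of <y>, <x y> and
   <x>.  Its flags form two orbits of the group, and an automorphism exchanging them would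
   make s = x y satisfy the same relations with y^-1 as with y.  So one word w with
   w(s, y) = 1 and w(s, y^-1) <> 1 forces chirality.

   The group is an affine group in dimension 4: y is multiplication by a primitive 8th root
   of unity zeta on Z[zeta] = Z^4, and s maps v to (v0, -v1, 1 - v2, 1 - v3).  The words in
   s and y with trivial linear part are the translations of 2 Z^4, and the linear parts form
   a group of order 64.  Dividing by the translations of 4 m L, where L runs through the
   ideals (1 - zeta)^k for k = 0, 1, 2, 3, gives groups of orders 2^(10 + k) m^4.  All of
   them are quotients of the group modulo 8 m, by the translations of 4 m C for the
   binary codes C of length 4 and dimension 4 - k given by L modulo 2.  Mirroring a suitable
   trivial word gives the translation (2, 2, -2, 2), which is not in 4 m Z^4. *)
Require Import Defs.
From HB Require Import structures.
From mathcomp Require Import all_boot all_order all_algebra all_fingroup all_solvable.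

Set Implicit Arguments.
Unset Strict Implicit.
Unset Printing Implicit Defensive.

Import Order.TTheory GRing.Theory Num.Theory.
Local Open Scope group_scope.

(** In a finite group the inverse of a generator is one of its powers, so plain products of
    generators exhaust the generated subgroup and no inverse case arises. *)
Lemma gen_closed_ind (gT : finGroupType) (A : {set gT}) (P : gT -> Prop) :
    P 1 -> (forall g h, P g -> P h -> P (g * h)) -> (forall g, g \in A -> P g) ->
  forall g, g \in <<A>> -> P g.
Proof.
move=> P1 PM PA g /gen_prodgP[n [c cA ->]].
by apply: big_ind => // i _; apply: PA.
Qed.

Notation o1 := (@Ordinal 5 1 isT).
Notation o2 := (@Ordinal 5 2 isT).
Notation o3 := (@Ordinal 5 3 isT).

Lemma ord5_ind (P : 'I_5 -> Prop) :
  P ord0 -> P o1 -> P o2 -> P o3 -> P ord_max -> forall r, P r.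
Proof.
move=> P0 P1 P2 P3 P4 [[|[|[|[|[|?]]]]] lr] //.
- by have -> : Ordinal lr = ord0 by apply: val_inj.
- by have -> : Ordinal lr = o1 by apply: val_inj.
- by have -> : Ordinal lr = o2 by apply: val_inj.
- by have -> : Ordinal lr = o3 by apply: val_inj.
by have -> : Ordinal lr = ord_max by apply: val_inj.
Qed.

(** * The polytope of a rotation group *)

(** Geometrically, [x] turns the base 2-face by one step, [y] turns around the base vertex, and the
    involution [x * y] reverses the base edge. *)
Record rotation_pair (gT : finGroupType) := RotationPair {
  rot_x : gT;
  rot_y : gT;
  rot_xy2 : rot_x * rot_y * (rot_x * rot_y) = 1;
  rot_tiX : <[rot_x]> :&: <[rot_y]> = 1;
  rot_x_neq1 : rot_x != 1;
  rot_y_neq1 : rot_y != 1;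
  rot_gen : <<[set rot_x; rot_y]>> = [set: gT]
}.

(** * Cosets as faces and their incidence order *)

Section CosetFaces.
Variables (gT : finGroupType) (p : rotation_pair gT).
Notation x := (rot_x p).
Notation y := (rot_y p).
Notation s := (x * y).

(* Ranks are shifted by 1, so that 0 and 4 are the ranks of the least and greatest faces. *)
Definition face_stab (r : nat) : {group gT} :=
  match r with
  | 1 => <[y]> | 2 => <[s]> | 3 => <[x]> | _ => [set: gT]
  end%G.

(** The rank is kept beside the coset because the least and the greatest face are the same set, the
    whole group. *)
Definition coset_face :=
  {p : 'I_5 * {set gT} | p.2 \in rcosets (face_stab p.1) [set: gT]}.
HB.instance Definition _ := Finite.on coset_face.

Definition face_rank (F : coset_face) : 'I_5 := (val F).1.
Definition face_coset (F : coset_face) : {set gT} := (val F).2.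

Lemma mk_face_subproof (r : 'I_5) g :
  (r, face_stab r :* g).2 \in rcosets (face_stab (r, face_stab r :* g).1) [set: gT].
Proof. by apply/rcosetsP; exists g; rewrite ?inE. Qed.

Definition mk_face (r : 'I_5) (g : gT) : coset_face :=
  Sub (r, face_stab r :* g) (mk_face_subproof r g).

Lemma face_mk F g : g \in face_coset F -> F = mk_face (face_rank F) g.
Proof.
case: F => [[r A] /= FA] gA; apply: val_inj => /=; congr (_, _).
case/rcosetsP: (FA) => h _ /= defA; rewrite /face_rank /= defA.
by apply/esym/rcoset_eqP; rewrite -defA.
Qed.

Lemma face_nonempty F : exists g, g \in face_coset F.
Proof.
case: F => [[r A] /= FA]; rewrite /face_coset /=.
by case/rcosetsP: (FA) => h _ /= ->; exists h; apply: rcoset_refl.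
Qed.

Lemma mem_mk_face r g h : (h \in face_coset (mk_face r g)) = (h * g^-1 \in face_stab r).
Proof. by rewrite /face_coset /= mem_rcoset. Qed.

Lemma mk_face_eq r g h : (mk_face r g == mk_face r h) = (g * h^-1 \in face_stab r).
Proof.
rewrite -mem_mk_face; apply/eqP/idP => [<-|]; first by rewrite mem_mk_face mulgV group1.
by move/face_mk.
Qed.

Definition face_le (F G : coset_face) : bool :=
  (F == G) || (face_rank F < face_rank G) && (face_coset F :&: face_coset G != set0).

Lemma face_leP F G :
  reflect (F = G \/ (face_rank F < face_rank G /\
             exists g, F = mk_face (face_rank F) g /\ G = mk_face (face_rank G) g))
          (face_le F G).
Proof.
apply: (iffP orP) => [[/eqP|/andP[ltFG /set0Pn[g]]]|[->|[ltFG [g [defF defG]]]]].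
- by left.
- by rewrite inE => /andP[/face_mk gF /face_mk gG]; right; split=> //; exists g.
- by rewrite eqxx; left.
right; rewrite ltFG; apply/set0Pn; exists g.
by rewrite defF defG inE !mem_mk_face mulgV !group1.
Qed.

Lemma face_le_refl : reflexive face_le.
Proof. by move=> F; rewrite /face_le eqxx. Qed.

Lemma face_le_anti : antisymmetric face_le.
Proof.
move=> F G /andP[/face_leP[//|[ltFG _]] /face_leP[->//|[ltGF _]]].
by move: (ltn_trans ltFG ltGF); rewrite ltnn.
Qed.

Lemma s2 : s * s = 1. Proof. exact: rot_xy2. Qed.

Lemma sV : s^-1 = s.
Proof. by apply/eqP; rewrite eq_invg_mul s2. Qed.

Lemma mem_cycle_s g : (g \in <[s]>) = (g == 1) || (g == s).
Proof.
apply/idP/orP => [/cycleP[i ->]|[]/eqP->]; rewrite ?group1 ?cycle_id //.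
rewrite -(odd_double_half i) addnC expgD -muln2 mulnC expgM expgS expg1 s2 expg1n mul1g.
by case: odd; rewrite eqxx; [right | left].
Qed.

(* If the edge coset is {g, s g}, the vertex at g and the face at s g = x (y g) meet in y g. *)
Lemma common_coset (r r' r'' : 'I_5) g h :
    r < r' -> r' < r'' -> g * h^-1 \in face_stab r' ->
  exists c, g * c^-1 \in face_stab r /\ h * c^-1 \in face_stab r''.
Proof.
case: r r' r'' => [[|[|[|[|[|?]]]]] ?] [[|[|[|[|[|?]]]]] ?] [[|[|[|[|[|?]]]]] ?] //= _ _;
  try (by exists h; rewrite ?inE ?mulgV ?group1);
  try (by exists g; rewrite ?inE ?mulgV ?group1).
rewrite mem_cycle_s => /orP[] /eqP gh.
  by exists g; rewrite mulgV group1 -groupV invMg invgK gh group1.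
exists (y * g); rewrite invMg mulgA mulgV mul1g groupV cycle_id; split=> //.
have ->: h = s * g by rewrite -[g](mulgKV h) gh mulgA s2 mul1g.
by rewrite !mulgA !mulgK cycle_id.
Qed.

(** The middle face has two representatives, [g] shared with the lower face and [h] shared with the
    upper one. [common_coset] exchanges them for a single representative [c] of both outer faces. *)
Lemma face_le_trans : transitive face_le.
Proof.
move=> G F K /face_leP[->//|[ltFG [g [defF defG]]]] /face_leP[<-|[ltGK [h [defG' defK]]]].
  by apply/face_leP; right; split=> //; exists g.
have: mk_face (face_rank G) g == mk_face (face_rank G) h by rewrite -defG -defG'.
rewrite mk_face_eq => /(common_coset ltFG ltGK)[c [gc hc]].
apply/face_leP; right; split; first exact: ltn_trans ltFG ltGK.
by exists c; split; [rewrite {1}defF|rewrite {1}defK]; apply/eqP; rewrite mk_face_eq.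
Qed.

Fact coset_face_display : Order.disp_t. Proof. exact: (Order.Disp tt tt). Qed.
HB.instance Definition _ := Order.Le_isPOrder.Build coset_face_display coset_face
  face_le_refl face_le_anti face_le_trans.

Lemma le_face F G : (F <= G)%O = face_le F G. Proof. by []. Qed.

Lemma lt_face F G : (F < G)%O =
  (face_rank F < face_rank G) && (face_coset F :&: face_coset G != set0).
Proof.
rewrite lt_neqAle le_face /face_le; case: eqVneq => [->|] //=.
by rewrite ltnn.
Qed.

Lemma face_rank_mk r g : face_rank (mk_face r g) = r. Proof. by []. Qed.

Lemma mk_face_le (r r' : 'I_5) g : r <= r' -> (mk_face r g <= mk_face r' g)%O.
Proof.
rewrite leq_eqVlt => /orP[/eqP/val_inj->//|ltr].
by rewrite le_face; apply/face_leP; right; split=> //; exists g.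
Qed.

Lemma comparable_rank_eq F G : (F >=< G)%O -> face_rank F = face_rank G -> F = G.
Proof.
move=> cFG eqr; case/orP: cFG; rewrite le_face => /face_leP[//|[]];
  by rewrite eqr ltnn.
Qed.

(** * Flags and their indices *)

Notation flag_ix := (gT * bool)%type.

(* The flags on the vertex and edge of g are (g, false), with the 2-face of g, and
   (g, true), with the 2-face of s g on the other side of the edge. *)
Definition flag_face (a : flag_ix) (r : 'I_5) : coset_face :=
  mk_face r (if r == 3%N :> nat then s ^+ a.2 * a.1 else a.1).

Definition flag_of (a : flag_ix) : {set coset_face} := [set flag_face a r | r : 'I_5].

Lemma mem_flag_of a F : (F \in flag_of a) = (F == flag_face a (face_rank F)).
Proof.
by apply/imsetP/eqP => [[r _ ->]|->] //; exists (face_rank F).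
Qed.

Lemma card_flag_of a : #|flag_of a| = 5.
Proof.
rewrite card_imset ?card_ord // => r r' /(congr1 face_rank).
by rewrite !face_rank_mk.
Qed.

Lemma flag_face_le a (r r' : 'I_5) : r <= r' -> (flag_face a r <= flag_face a r')%O.
Proof.
rewrite leq_eqVlt => /orP[/eqP/val_inj->//|ltr].
suff [c [c1 c2]]: exists c, flag_face a r = mk_face r c /\ flag_face a r' = mk_face r' c.
  by rewrite c1 c2 mk_face_le 1?ltnW.
case: a => g [] /=; last first.
  by exists g; rewrite /flag_face /= mul1g !if_same.
(* The 2-face of [(g, true)] is that of [s * g]. It meets the vertex of [g] in [y * g], since
   [s * g = x * (y * g)], and the edge in [s * g]; pairs without the 2-face share [g]. *)
exists (if r' == 3%N :> nat then if r == 1%N :> nat then y * g else s * g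
        else if r == 3%N :> nat then s * g else g).
rewrite /flag_face; split; apply/eqP; rewrite mk_face_eq;
  case: r' r ltr => [[|[|[|[|[|?]]]]] ?] [[|[|[|[|?]]]] ?] //= _;
  rewrite ?inE ?expg1 ?mulgV ?group1 ?cycle_id //;
  try (by rewrite !mulgA !mulgK cycle_id);
  try (by rewrite invMg mulgA mulgV mul1g groupV cycle_id);
  by rewrite invMg !mulgA !mulgK cycle_id.
Qed.

Lemma flag_face_lt a (r r' : 'I_5) : r < r' -> (flag_face a r < flag_face a r')%O.
Proof.
move=> ltr; rewrite lt_neqAle flag_face_le ?(ltnW ltr) // andbT.
by apply: contraTneq ltr => /(congr1 face_rank); rewrite !face_rank_mk => ->; rewrite ltnn.
Qed.

Lemma flag_of_chain a : is_chain (flag_of a).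
Proof.
apply/'forall_in_forall_inP => _ /imsetP[r _ ->] _ /imsetP[r' _ ->].
rewrite /Order.comparable; case/orP: (leq_total r r') => /flag_face_le -> //.
by rewrite orbT.
Qed.

Lemma flag_of_flag a : is_flag (flag_of a).
Proof.
apply/maxsetP; split=> [|C chC sub]; first exact: flag_of_chain.
apply/eqP; rewrite eqEsubset sub andbT; apply/subsetP => F FC.
rewrite mem_flag_of; apply/eqP/comparable_rank_eq => //.
have := forall_inP (forall_inP chC _ FC); apply.
by apply: (subsetP sub); apply: imset_f.
Qed.

(** Incident faces share a representative [g], and every face of the flag [(g, false)] is
    represented by [g]. *)
Lemma incident_flag F G : (F >=< G)%O ->
  exists g, F \in flag_of (g, false) /\ G \in flag_of (g, false).
Proof.
wlog: F G / (F <= G)%O => [IH cFG|].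
  case/orP: (cFG) => /IH; first exact.
  by rewrite comparable_sym => /(_ cFG)[g []]; exists g.
rewrite le_face => /face_leP[-> _|[_ [g [defF defG]] _]].
  have [g /face_mk->] := face_nonempty G; exists g.
  by rewrite mem_flag_of /flag_face mul1g if_same.
by exists g; rewrite !mem_flag_of /flag_face /= mul1g !if_same -defF -defG.
Qed.

(** The improper faces lie in every flag and comparable faces of equal rank coincide, so a chain
    matters only through at most one face in each of the ranks 1, 2 and 3. Up to two such faces are
    handled by [incident_flag]. *)
Lemma chain_sub_flag (C : {set coset_face}) : is_chain C -> exists a, C \subset flag_of a.
Proof.
move=> chC.
have cmp F G : F \in C -> G \in C -> (F >=< G)%O.
  by move=> FC GC; apply: (forall_inP (forall_inP chC _ FC)).
have pick_rank (r : 'I_5) : (forall F, F \in C -> face_rank F <> r) \/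
    (exists F, [/\ F \in C, face_rank F = r &
               forall G, G \in C -> face_rank G = r -> G = F]).
  have [/existsP[F /andP[FC /eqP rF]]|/existsPn nex] :=
      boolP [exists F, (F \in C) && (face_rank F == r)].
    right; exists F; split=> // G GC rG; apply: comparable_rank_eq; last by rewrite rG.
    exact: cmp.
  by left=> F FC rF; move: (nex F); rewrite FC rF eqxx.
suff [a Ha]: exists a, forall F, F \in C -> 0 < face_rank F < 4 -> F \in flag_of a.
  exists a; apply/subsetP => F FC.
  have := Ha F FC; rewrite mem_flag_of.
  have [g /face_mk->] := face_nonempty F.
  case: (face_rank F) => [[|[|[|[|[|?]]]]] ltr] //= H; try exact: H.
    by rewrite mk_face_eq inE.
  by rewrite mk_face_eq inE.
pose o1 : 'I_5 := @Ordinal 5 1 isT; pose o2 : 'I_5 := @Ordinal 5 2 isT.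
pose o3 : 'I_5 := @Ordinal 5 3 isT.
have split_rank F : F \in C -> 0 < face_rank F < 4 ->
    [\/ face_rank F = o1, face_rank F = o2 | face_rank F = o3].
  move=> _; case: (face_rank F) => [[|[|[|[|[|?]]]]] ltr] //= _;
  by [apply: Or31; apply: val_inj | apply: Or32; apply: val_inj | apply: Or33; apply: val_inj].
have pair F G : F \in C -> G \in C ->
    (forall K, K \in C -> 0 < face_rank K < 4 -> K = F \/ K = G) ->
    exists a, forall K, K \in C -> 0 < face_rank K < 4 -> K \in flag_of a.
  move=> FC GC FG; have [g [gF gG]] := incident_flag (cmp _ _ FC GC).
  by exists (g, false) => K KC /(FG K KC)[]->.
case: (pick_rank o1) => [no1 | [V [VC rV Vuniq]]];
case: (pick_rank o2) => [no2 | [E [EC rE Euniq]]];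
case: (pick_rank o3) => [no3 | [F [FC rF Funiq]]].
- by exists (1, false) => K KC /(split_rank K KC)[/(no1 K KC)|/(no2 K KC)|/(no3 K KC)].
- apply: (pair F F) => // K KC /(split_rank K KC)[/(no1 K KC)|/(no2 K KC)|/(Funiq K KC)]; by auto.
- apply: (pair E E) => // K KC /(split_rank K KC)[/(no1 K KC)|/(Euniq K KC)|/(no3 K KC)]; by auto.
- apply: (pair E F) => // K KC /(split_rank K KC)[/(no1 K KC)|/(Euniq K KC)|/(Funiq K KC)]; by auto.
- apply: (pair V V) => // K KC /(split_rank K KC)[/(Vuniq K KC)|/(no2 K KC)|/(no3 K KC)]; by auto.
- apply: (pair V F) => // K KC /(split_rank K KC)[/(Vuniq K KC)|/(no2 K KC)|/(Funiq K KC)]; by auto.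
- apply: (pair V E) => // K KC /(split_rank K KC)[/(Vuniq K KC)|/(Euniq K KC)|/(no3 K KC)]; by auto.
have [g [Vg Eg]] := incident_flag (cmp _ _ VC EC).
have [h [Eh Fh]] := incident_flag (cmp _ _ EC FC).
(* Vertex and edge meet at [g], edge and 2-face at [h]. Both lie in one coset of [<[s]>], so [h] is
   [g] or [s * g], which is what the boolean records. *)
exists (g, g != h) => K KC /(split_rank K KC)[/(Vuniq K KC)->|/(Euniq K KC)->|/(Funiq K KC)->].
- by move: Vg; rewrite !mem_flag_of rV.
- by move: Eg; rewrite !mem_flag_of rE.
move: Eg Eh Fh; rewrite !mem_flag_of rE rF => /eqP-> + /eqP->.
rewrite /flag_face !mk_face_eq /= mul1g mem_cycle_s.
have [->|ne_gh /=] := eqVneq g h; first by rewrite mul1g mulgV group1.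
rewrite -eq_mulgV1 (negbTE ne_gh) /= => /eqP gh.
have ->: g = s * h by rewrite -gh mulgKV.
by rewrite expg1 (mulgA s s) s2 mul1g mulgV group1.
Qed.

Lemma flagP (Phi : {set coset_face}) : is_flag Phi -> exists a, Phi = flag_of a.
Proof.
case/maxsetP=> /chain_sub_flag[a sub] maxPhi.
by exists a; rewrite (maxPhi _ (flag_of_chain a) sub).
Qed.

(** * Adjacent flags and the diamond condition *)

Lemma mem_cycle_xy_eq1 g : g \in <[x]> -> g \in <[y]> -> g = 1.
Proof. by move=> gx gy; apply/set1gP; rewrite -(rot_tiX p) inE gx. Qed.

Lemma s_notin_y : s \notin <[y]>.
Proof.
apply/negP; rewrite groupMr ?cycle_id // => /(mem_cycle_xy_eq1 (cycle_id x)) x1.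
by have := rot_x_neq1 p; rewrite x1 eqxx.
Qed.

Lemma s_notin_x : s \notin <[x]>.
Proof.
apply/negP; rewrite groupMl ?cycle_id // => /mem_cycle_xy_eq1 /(_ (cycle_id y)) y1.
by have := rot_y_neq1 p; rewrite y1 eqxx.
Qed.

(* [rho r a] indexes the flag adjacent to that of [a] in rank r; it always changes the
   boolean, which labels the two orbits of the rotation group. *)
Definition rho (r : nat) (a : flag_ix) : flag_ix :=
  match r with
  | 1 => (s * a.1, ~~ a.2)
  | 2 => ((if a.2 then y else y^-1) * a.1, ~~ a.2)
  | 3 => (a.1, ~~ a.2)
  | _ => a
  end.

Lemma rhoK r : involutive (rho r).
Proof.
case: r => [|[|[|[|r]]]] [g e] //=; rewrite ?negbK //.
  by rewrite mulgA s2 mul1g.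
by case: e; rewrite ?mulKg ?mulKVg.
Qed.

Lemma flag_face_eq a b (r : 'I_5) :
  (flag_face a r == flag_face b r) =
    ((if r == 3%N :> nat then s ^+ a.2 * a.1 else a.1) *
     (if r == 3%N :> nat then s ^+ b.2 * b.1 else b.1)^-1 \in face_stab r).
Proof. exact: mk_face_eq. Qed.

(** With one flag written relative to the other, [g] cancels, and comparing flags becomes a
    condition on the displacement [h] and the two booleans. *)
Lemma flag_face_eq_mul (r : 'I_5) g h e e' :
  (flag_face (h * g, e') r == flag_face (g, e) r) =
    match r : nat with
    | 1 => h \in <[y]>
    | 2 => (h == 1) || (h == s)
    | 3 => s ^+ e' * h * s ^+ e \in <[x]>
    | _ => true
    end.
Proof.
rewrite flag_face_eq; case: r => [[|[|[|[|[|?]]]]] ?] //=; rewrite ?inE //.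
- by rewrite mulgK.
- by rewrite mem_cycle_s mulgK.
by rewrite invMg !mulgA mulgK -expgVn sV.
Qed.

Lemma ys_x : y * s = x^-1.
Proof. by rewrite -[LHS]invgK invMg sV mulgK. Qed.

Lemma rho_agree (r r' : 'I_5) a : r' != r -> flag_face (rho r a) r' = flag_face a r'.
Proof.
case: a => g e ne; apply/eqP.
have -> : rho r (g, e) = ((rho r (1, e)).1 * g, (rho r (1, e)).2).
  by case: r ne => [[|[|[|[|[|?]]]]] ?] ne /=; rewrite ?mulg1 ?mul1g.
rewrite flag_face_eq_mul.
case: r r' ne => [[|[|[|[|[|?]]]]] ?] [[|[|[|[|[|?]]]]] ?] //= _;
  rewrite ?mulg1 ?mul1g ?group1 ?eqxx ?orbT //.
1,5: by case: e; rewrite ?expg0 ?expg1 ?mulg1 ?s2 group1.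
- by case: e; rewrite ?expg0 ?expg1 ?mul1g ?mulg1 s2 group1.
- by case: e; rewrite ?groupV cycle_id.
case: e; rewrite ?expg0 ?expg1 ?mul1g ?mulg1.
  by rewrite ys_x groupV cycle_id.
by rewrite mulgK cycle_id.
Qed.

(* The diamond condition, in terms of flags. *)
Lemma diamond (r : 'I_5) a b :
    (forall r' : 'I_5, r' != r -> flag_face b r' = flag_face a r') ->
  b = a \/ (b = rho r a /\ 0 < r < 4).
Proof.
case: a b => g e [g' e']; rewrite -(mulgKV g g'); set h := g' * g^-1 => ab.
have {}ab r' : r' != r -> flag_face (h * g, e') r' == flag_face (g, e) r'.
  by move/ab->.
have ab1 := ab (@Ordinal 5 1 isT); have ab2 := ab (@Ordinal 5 2 isT).
have ab3 := ab (@Ordinal 5 3 isT); move: ab1 ab2 ab3 {ab}.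
rewrite !flag_face_eq_mul /=.
have v_e : (h \in <[y]>) -> (h == 1) || (h == s) -> h = 1.
  by move=> hy /orP[/eqP//|/eqP hs]; move: hy; rewrite hs (negbTE s_notin_y).
have f1 : s ^+ e' * s ^+ e \in <[x]> -> e' = e.
  case: e e' => [] []; rewrite //= ?expg0 ?expg1 ?mul1g ?mulg1 (negbTE s_notin_x) //.
have fs : s ^+ e' * s * s ^+ e \in <[x]> -> e' = ~~ e.
  case: e {f1} e' => [] []; rewrite //= ?expg0 ?expg1 ?mul1g ?mulg1 ?s2 ?mul1g (negbTE s_notin_x) //.
case: r => [[|[|[|[|[|?]]]]] ?] //= ab1 ab2 ab3.
- by move: ab3; rewrite (v_e (ab1 isT) (ab2 isT)) mul1g mulg1 => /(_ isT)/f1->; left.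
- move: ab3; case/orP: (ab2 isT) => /eqP->; rewrite ?mul1g ?mulg1 => /(_ isT).
    by move/f1->; left.
  by move/fs->; right.
(* Vertex and 2-face are shared: [h] is in [<[y]>] and [s ^+ e' * h * s ^+ e] is in [<[x]>]. As
   these cyclic groups meet trivially, [h] is 1 if [e' = e], and otherwise [y] or [y^-1] according
   to [e]. *)
- move: (ab1 isT) (ab3 isT).
  case: e e' {f1 fs ab1 ab2 ab3} => [] []; rewrite /= ?expg0 ?expg1 ?mul1g ?mulg1 => hy.
  + have -> : s * h * s = x * (y * h * y^-1) * x^-1 by rewrite -{2}sV invMg !mulgA.
    rewrite groupMr ?groupV ?cycle_id // groupMl ?cycle_id // => hx.
    left; suff -> : h = 1 by rewrite mul1g.
    apply: (conjg_inj y^-1); rewrite conj1g conjgE invgK.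
    apply: mem_cycle_xy_eq1; first by rewrite mulgA.
    by rewrite groupMl ?cycle_id // groupMr ?groupV ?cycle_id.
  + rewrite -[X in _ * X]sV invMg mulgA groupMr ?groupV ?cycle_id // => hx.
    right; split=> //; congr (_ * _, _); apply/eqP; rewrite eq_mulgV1; apply/eqP.
    by apply: mem_cycle_xy_eq1; rewrite // groupM ?groupV ?cycle_id.
  + rewrite -mulgA groupMl ?cycle_id // => hx.
    right; split=> //; congr (_ * _, _); apply/eqP; rewrite eq_sym eq_invg_mul; apply/eqP.
    by apply: mem_cycle_xy_eq1; rewrite // groupM ?groupV ?cycle_id.
  + by move/mem_cycle_xy_eq1/(_ hy)->; left; rewrite mul1g.
- rewrite (v_e (ab1 isT) (ab2 isT)) mul1g.
  by case: e e' {f1 fs ab3} => [] []; [left|right|right|left].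
by move: ab3; rewrite (v_e (ab1 isT) (ab2 isT)) mul1g mulg1 => /(_ isT)/f1->; left.
Qed.

Lemma flag_of_eq a b : flag_of a = flag_of b -> forall r, flag_face a r = flag_face b r.
Proof.
move=> eqf r; apply/eqP; rewrite -[r in flag_face b r](face_rank_mk r a.1).
by have := mem_flag_of b (flag_face a r); rewrite -eqf imset_f // => /esym.
Qed.

(** At rank 0 there is no adjacent flag, so [diamond] leaves only equality. *)
Lemma flag_of_inj : injective flag_of.
Proof.
by move=> a b /flag_of_eq eqf; case: (@diamond ord0 b a) => [r _||[]].
Qed.

Lemma rho_neq (r : 'I_5) a : 0 < r < 4 -> flag_face (rho r a) r <> flag_face a r.
Proof.
move=> r14 eqr; suff: rho r a = a.
  by case: r r14 {eqr} => [[|[|[|[|[|?]]]]] ?] //= _; case: a => g [].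
apply: flag_of_inj; apply: eq_in_imset => r' _.
by have [->//|/rho_agree] := eqVneq r' r.
Qed.

Definition int_rank (F : coset_face) : int := (face_rank F)%:Z - 1.

Lemma int_rank_eq F G : (int_rank F == int_rank G) = (face_rank F == face_rank G).
Proof. by rewrite /int_rank (inj_eq (addIr _)). Qed.

Lemma mem_flag_ofD1 a (r : 'I_5) F :
  (F \in flag_of a :\ flag_face a r) = (face_rank F != r) && (F == flag_face a (face_rank F)).
Proof.
rewrite in_setD1 mem_flag_of; have [rF|ne] := eqVneq (face_rank F) r.
  by rewrite rF andNb.
by rewrite andb_idl //= => _; apply: contraNneq ne => ->.
Qed.

Lemma adjacentP a b :
  reflect (exists2 r : 'I_5, 0 < r < 4 & b = rho r a)
          (adjacent int_rank (flag_of a) (flag_of b)).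
Proof.
apply: (iffP existsP) => [[F]|[r r14 ->]].
  case/'exists_in_existsP=> F1 Fa [F2] /and5P[Fb neF] /eqP r1 /eqP r2 /eqP eqD.
  move: Fa Fb; rewrite !mem_flag_of => /eqP Fa /eqP Fb.
  have eqr: face_rank F1 = face_rank F2 by apply/eqP; rewrite -int_rank_eq r1 r2.
  have [r' ne||[->]] := @diamond (face_rank F1) a b.
  - have: flag_face a r' \in flag_of a :\ F1 by rewrite Fa mem_flag_ofD1 eqxx ne.
    by rewrite eqD Fb mem_flag_ofD1 => /andP[_ /eqP].
  - by move=> eqab; move: neF; rewrite Fa Fb eqab eqr eqxx.
  by exists (face_rank F1).
exists (flag_face a r); apply/'exists_in_existsP; exists (flag_face a r); first exact: imset_f.
exists (flag_face (rho r a) r).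
rewrite imset_f //; apply/and5P; split; rewrite ?int_rank_eq //.
  by rewrite eq_sym; apply/eqP/rho_neq.
apply/eqP/setP => F; rewrite !mem_flag_ofD1.
by have [//|ne] := eqVneq (face_rank F) r; rewrite rho_agree.
Qed.

(** Exchanging the middle face of the flag for [H] leaves a chain. It lies in a flag that agrees
    with [a] outside rank [r'], and [diamond] allows only two of these. *)
Lemma between_flag a (i : nat) (r r' r'' : 'I_5) H :
    r = i :> nat -> r' = i.+1 :> nat -> r'' = i.+2 :> nat -> face_rank H = r' ->
    (flag_face a r < H < flag_face a r'')%O ->
  H = flag_face a r' \/ H = flag_face (rho r' a) r'.
Proof.
move=> ri r'i r''i rH /andP[ltaH ltHa].
have chC: is_chain (H |: (flag_of a :\ flag_face a r')).
  have cH G : G \in flag_of a :\ flag_face a r' -> (H >=< G)%O.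
    rewrite mem_flag_ofD1 => /andP[]; move: (face_rank G) => k ne /eqP->.
    have [lekr|] := leqP k r'; rewrite /Order.comparable.
      have: (flag_face a k <= flag_face a r)%O.
        by apply: flag_face_le; rewrite ri -ltnS -r'i ltn_neqAle lekr andbT.
      by move=> /le_trans/(_ (ltW ltaH)) ->; rewrite orbT.
    rewrite r'i -r''i => /flag_face_le - /(_ a) /(le_trans (ltW ltHa)) -> //.
  apply/'forall_in_forall_inP => F; rewrite in_setU1 => FC G; rewrite in_setU1 => GC.
  case/predU1P: FC GC => [->|FC] /predU1P[->|GC].
  - exact: comparablexx.
  - exact: cH.
  - by rewrite comparable_sym; apply: cH.
  have := forall_inP (forall_inP (flag_of_chain a) F _) G.
  by move: FC GC; rewrite !in_setD1 => /andP[_ FC] /andP[_ GC]; apply.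
have [b /subsetP Cb] := chain_sub_flag chC.
have Hb: H = flag_face b r'.
  by apply/eqP; rewrite -rH -mem_flag_of Cb ?setU11.
case: (@diamond r' a b) => [k ne||[eqb _]].
- have : flag_face a k \in flag_of b.
    by apply: Cb; rewrite in_setU1 mem_flag_ofD1 eqxx ne orbT.
  by rewrite mem_flag_of => /eqP.
- by move=> eqb; left; rewrite Hb eqb.
by right; rewrite -eqb.
Qed.

(** * Strong flag-connectedness *)

Definition reach (A : pred 'I_5) (a b : flag_ix) : Prop :=
  exists2 l : seq 'I_5, all (fun r : 'I_5 => (0 < r < 4) && A r) l &
    b = foldl (fun c (r : 'I_5) => rho r c) a l.

Lemma reach_refl A a : reach A a a. Proof. by exists [::]. Qed.

Lemma reach_trans A b a c : reach A a b -> reach A b c -> reach A a c.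
Proof.
by case=> l Al -> [l' Al' ->]; exists (l ++ l'); rewrite ?all_cat ?Al // foldl_cat.
Qed.

Lemma reach_rho (A : pred 'I_5) (r : 'I_5) a : 0 < r < 4 -> A r -> reach A a (rho r a).
Proof. by move=> r14 Ar; exists [:: r]; rewrite /= ?r14 ?Ar. Qed.

Lemma reach_sym A a b : reach A a b -> reach A b a.
Proof.
case=> l Al ->; exists (rev l); first by rewrite all_rev.
elim: l a Al => [|r l IH] a //= /andP[_ /IH{IH} def_a].
by rewrite rev_cons -cats1 foldl_cat -def_a /= rhoK.
Qed.

Lemma reach_mul (A : pred 'I_5) (B : {set gT}) :
    (forall h g, h \in B -> reach A (g, false) (h * g, false)) ->
  forall h g, h \in <<B>> -> reach A (g, false) (h * g, false).
Proof.
move=> AB h g hB; move: h hB g; apply: gen_closed_ind => [g|h k Rh Rk g|h hB g].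
- by rewrite mul1g; apply: reach_refl.
- by rewrite -mulgA; apply: reach_trans (Rk _) (Rh _).
exact: AB.
Qed.

Lemma reach_y (A : pred 'I_5) g : A o2 -> A o3 -> reach A (g, false) (y * g, false).
Proof.
move=> A2 A3; apply: (@reach_trans _ (g, true)); first exact: (@reach_rho A o3).
exact: (@reach_rho A o2 (g, true)).
Qed.

Lemma reach_x (A : pred 'I_5) g : A o1 -> A o2 -> reach A (g, false) (x * g, false).
Proof.
move=> A1 A2; apply: reach_sym; rewrite -{2}[g](mulKg x) -ys_x -mulgA.
apply: (@reach_trans _ (s * (x * g), true)); first exact: (@reach_rho A o1 (x * g, false)).
exact: (@reach_rho A o2 (s * (x * g), true)).
Qed.

(** Moves in the ranks where the flags differ keep all common faces. If at most one rank differs,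
    [diamond] applies. Once the booleans are cleared, the displacement lies in [<[x]>] if only the
    2-face is shared, in [<[y]>] if only the vertex is, and in the group generated by both if
    neither these nor the edge are; pairs of moves realise the generators. If only the edge is
    shared, at most two moves, of ranks 1 and 3, suffice. *)
Lemma reach_flag a b : reach (fun r => flag_face a r != flag_face b r) a b.
Proof.
set A : pred 'I_5 := fun r => _.
have single (r : 'I_5) : (forall r', r' != r -> ~~ A r') -> reach A a b.
  move=> Ar; case: (@diamond r a b) => [r' /Ar/negPn/eqP->//|eqb|[eqb r14]].
    by rewrite eqb; apply: reach_refl.
  have [Arr|/negPn/eqP eqr] := boolP (A r); first by rewrite eqb; apply: reach_rho.
  suff -> : b = a by apply: reach_refl.
  apply: flag_of_inj; apply: eq_in_imset => r' _.
  by have [->//|/Ar/negPn/eqP->] := eqVneq r' r.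
have A0 : ~~ A ord0 by rewrite /A flag_face_eq inE.
have A4 : ~~ A ord_max by rewrite /A flag_face_eq inE.
have [A1|nA1] := boolP (A o1); have [A2|nA2] := boolP (A o2);
  have [A3|nA3] := boolP (A o3).
- have to_false c : reach A c (c.1, false).
    by case: c => g [] /=; [apply: (@reach_rho A o3) | apply: reach_refl].
  apply: reach_trans (to_false a) (reach_trans _ (reach_sym (to_false b))).
  rewrite -[b.1](mulgKV a.1); apply: (@reach_mul _ [set x; y]).
    by move=> h g /set2P[]->; [apply: reach_x | apply: reach_y].
  by rewrite rot_gen inE.
- have to_false c : reach A c (s ^+ c.2 * c.1, false).
    case: c => g [] /=; last by rewrite mul1g; apply: reach_refl.
    by rewrite expg1; apply: (@reach_rho A o1 (g, true)).
  apply: reach_trans (to_false a) (reach_trans _ (reach_sym (to_false b))).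
  rewrite -[s ^+ b.2 * _](mulgKV (s ^+ a.2 * a.1)); apply: (@reach_mul _ [set x]).
    by move=> h g /set1P->; apply: reach_x.
  by move: nA3; rewrite negbK eq_sym flag_face_eq.
- have Es: b.1 * a.1^-1 \in <[s]> by move: nA2; rewrite negbK eq_sym flag_face_eq.
  move: Es; rewrite mem_cycle_s -eq_mulgV1; case/orP => /eqP eqb.
    by move: A1; rewrite /A flag_face_eq /= eqb mulgV group1.
  have r1: reach A a (rho 1 a) by apply: (@reach_rho A o1).
  have {}eqb: b.1 = s * a.1 by rewrite -eqb mulgKV.
  apply: reach_trans r1 _; case: (a) (b) eqb => g e [h e'] /= ->.
  have [->|ne] := eqVneq e' (~~ e); first exact: reach_refl.
  have -> : (s * g, e') = rho 3 (s * g, ~~ e) by case: (e) (e') ne => [] [].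
  exact: (@reach_rho A o3).
- by apply: (single o1); apply: ord5_ind.
- have to_false c : reach A c (c.1, false).
    by case: c => g [] /=; [apply: (@reach_rho A o3) | apply: reach_refl].
  apply: reach_trans (to_false a) (reach_trans _ (reach_sym (to_false b))).
  rewrite -[b.1](mulgKV a.1); apply: (@reach_mul _ [set y]).
    by move=> h g /set1P->; apply: reach_y.
  by move: nA1; rewrite negbK eq_sym flag_face_eq.
- by apply: (single o2); apply: ord5_ind.
- by apply: (single o3); apply: ord5_ind.
by apply: (single ord0); apply: ord5_ind.
Qed.

Lemma reach_path (A : pred 'I_5) a b : reach A a b ->
  exists t : seq {set coset_face},
    [/\ path (adjacent int_rank) (flag_of a) t, last (flag_of a) t = flag_of b &
        forall X, X \in t ->
          is_flag X /\ forall r, ~~ A r -> flag_face a r \in X].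
Proof.
case=> l; elim: l a => [|r l IH] a /=; first by move=> _ ->; exists [::].
case/andP=> /andP[r14 Ar] /IH{}IH /IH[t [pt lt tA]].
exists (flag_of (rho r a) :: t); split=> //=.
  by rewrite pt andbT; apply/adjacentP; exists r.
have keep k : ~~ A k -> flag_face (rho r a) k = flag_face a k.
  by move=> nAk; apply: rho_agree; apply: contraNneq nAk => ->.
move=> X; rewrite inE => /predU1P[->|/tA[flX XA]].
  by split; [apply: flag_of_flag | move=> k /keep<-; apply: imset_f].
by split=> // k nAk; rewrite -keep // XA.
Qed.

(** * The polytope axioms *)

Lemma coset_rank_lt F G : (F < G)%O -> (int_rank F < int_rank G)%R.
Proof. by rewrite lt_face => /andP[ltr _]; rewrite /int_rank ltrD2r ltz_nat. Qed.

Lemma coset_rank_range (j : int) :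
  (exists F, int_rank F = j) <-> (-1 <= j <= 3%N%:Z)%R.
Proof.
split=> [[F <-]|].
  by rewrite /int_rank; case: (face_rank F) => [[|[|[|[|[|?]]]]] ?].
case: j => [[|[|[|[|j]]]]|[|j]] // _.
- by exists (mk_face o1 1).
- by exists (mk_face o2 1).
- by exists (mk_face o3 1).
- by exists (mk_face ord_max 1).
by exists (mk_face ord0 1).
Qed.

Lemma mk_face0_le g F : (mk_face ord0 g <= F)%O.
Proof.
have [h /face_mk->] := face_nonempty F.
have /eqP-> : mk_face ord0 g == mk_face ord0 h by rewrite mk_face_eq inE.
exact: mk_face_le.
Qed.

Lemma le_mk_face4 g F : (F <= mk_face ord_max g)%O.
Proof.
have [h /face_mk->] := face_nonempty F.
have /eqP-> : mk_face ord_max g == mk_face ord_max h by rewrite mk_face_eq inE.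
by apply: mk_face_le; rewrite -ltnS.
Qed.

Lemma coset_P1 : (exists Fmin : coset_face, forall F : coset_face, (Fmin <= F)%O) /\
                 (exists Fmax : coset_face, forall F : coset_face, (F <= Fmax)%O).
Proof.
split; first by exists (mk_face ord0 1) => F; apply: mk_face0_le.
by exists (mk_face ord_max 1) => F; apply: le_mk_face4.
Qed.

Lemma coset_P2 (Phi : {set coset_face}) : is_flag Phi -> #|Phi| = 5.
Proof. by move=> /flagP[a ->]; apply: card_flag_of. Qed.

Lemma coset_P3 (Phi Psi : {set coset_face}) : is_flag Phi -> is_flag Psi ->
  exists t : seq {set coset_face},
    [/\ path (adjacent int_rank) Phi t, last Phi t = Psi &
        forall X, X \in t -> is_flag X /\ Phi :&: Psi \subset X].
Proof.
move=> /flagP[a ->] /flagP[b ->].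
have [t [pt lt tA]] := reach_path (reach_flag a b).
exists t; split=> // X /tA[flX XA]; split=> //.
apply/subsetP => F; rewrite inE !mem_flag_of => /andP[/eqP Fa /eqP Fb].
by rewrite Fa XA // negbK -Fa -Fb.
Qed.

Lemma coset_P4 (i : nat) (F G : coset_face) : (i < 3)%N -> (F < G)%O ->
  int_rank F = (i%:Z - 1)%R -> int_rank G = (i%:Z + 1)%R ->
  #|[set H : coset_face | (int_rank H == i%:Z%R) && (F < H < G)%O]| = 2%N.
Proof.
move=> i3 ltFG rF rG.
have {}rF : face_rank F = i :> nat by move/addIr: rF => [].
have {}rG : face_rank G = i.+2 :> nat.
  by move/(canRL (subrK _)): rG; rewrite -!PoszD => -[->]; rewrite addn1 addn1.
have [g [Fg Gg]] : exists g, F \in flag_of (g, false) /\ G \in flag_of (g, false).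
  by apply: incident_flag; rewrite /Order.comparable ltW.
set a := (g, false) in Fg Gg.
have i5 : i.+1 < 5 by rewrite ltnS ltnW.
pose r' := Ordinal i5.
have r14 : 0 < r' < 4 by [].
move: Fg Gg; rewrite !mem_flag_of => /eqP Fa /eqP Ga.
have lt_r' c : (flag_face c (face_rank F) < flag_face c r' < flag_face c (face_rank G))%O.
  by rewrite !flag_face_lt ?rF ?rG.
have -> : [set H | (int_rank H == i%:Z%R) && (F < H < G)%O] =
          [set flag_face a r'; flag_face (rho r' a) r'].
  apply/setP => H; rewrite !inE; apply/andP/orP => [[/eqP rH FHG]|].
    have {}rH : face_rank H = r'.
      by apply: val_inj; move/(canRL (subrK _)): rH; rewrite -PoszD addn1 => -[].
    by case: (@between_flag a i _ r' _ H rF _ rG) => // [|->|->]; rewrite -?Fa -?Ga; auto.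
  have rk_r' c : int_rank (flag_face c r') = i%:Z%R.
    by rewrite /int_rank face_rank_mk /= -addn1 PoszD addrK.
  have neF : face_rank F != r' by rewrite -val_eqE /= rF ltn_eqF.
  have neG : face_rank G != r' by rewrite -val_eqE /= rG gtn_eqF.
  have lt1 := lt_r' a; have lt2 := lt_r' (rho r' a).
  rewrite (rho_agree _ neF) (rho_agree _ neG) in lt2.
  by rewrite -Fa -Ga in lt1 lt2; case=> /eqP->; rewrite rk_r'.
by rewrite cards2 eq_sym; case: eqP => // /(rho_neq r14).
Qed.

Definition coset_polytope : polytope 3 :=
  @Polytope 3 _ coset_face int_rank coset_rank_lt coset_rank_range coset_P1 coset_P2
    coset_P3 coset_P4.

(** * Right multiplication and automorphisms *)

Lemma act_face_subproof (h : gT) (F : coset_face) :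
  (face_rank F, face_coset F :* h).2
    \in rcosets (face_stab (face_rank F, face_coset F :* h).1) [set: gT].
Proof.
have [g /face_mk->] := face_nonempty F.
by apply/rcosetsP; exists (g * h); rewrite ?inE //= -rcosetM.
Qed.

Definition act_face (h : gT) (F : coset_face) : coset_face :=
  Sub (face_rank F, face_coset F :* h) (act_face_subproof h F).

Lemma act_face_mk h r g : act_face h (mk_face r g) = mk_face r (g * h).
Proof. by apply: val_inj => /=; rewrite /face_coset /= -rcosetM. Qed.

Lemma act_face_inj h : injective (act_face h).
Proof.
apply: (can_inj (g := act_face h^-1)) => F.
by have [g /face_mk->] := face_nonempty F; rewrite !act_face_mk mulgK.
Qed.

Lemma act_flag_face h g e r : act_face h (flag_face (g, e) r) = flag_face (g * h, e) r.
Proof. by rewrite act_face_mk; congr mk_face; case: ifP => //=; rewrite mulgA. Qed.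

Definition act_perm (h : gT) : {perm coset_polytope} := perm (@act_face_inj h).

Lemma act_permM : {in [set: gT] &, {morph act_perm : h k / h * k}}.
Proof.
move=> h k _ _; apply/permP => F; rewrite permM !permE.
by have [g /face_mk->] := face_nonempty F; rewrite !act_face_mk mulgA.
Qed.
Canonical act_perm_morphism := Morphism act_permM.

Lemma act_face_le h F G : (act_face h F <= act_face h G)%O = (F <= G)%O.
Proof.
suff homo k F' G' : (F' <= G')%O -> (act_face k F' <= act_face k G')%O.
  apply/idP/idP => [/(homo h^-1)|]; last exact: homo.
  have K F' : act_face h^-1 (act_face h F') = F'.
    by have [g /face_mk->] := face_nonempty F'; rewrite !act_face_mk mulgK.
  by rewrite !K.
rewrite {1}le_face => /face_leP[->//|[ltr [g [-> ->]]]].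
by rewrite !act_face_mk mk_face_le // ltnW.
Qed.

Lemma act_perm_aut h : act_perm h \in polytope_aut coset_polytope.
Proof.
rewrite inE; apply/forallP => F; apply/forallP => G.
by rewrite !permE act_face_le.
Qed.

Lemma act_perm_injm : 'injm act_perm_morphism.
Proof.
apply/injmP => h k _ _ /permP eqhk.
suff : (1 * h, false) = (1 * k, false) by rewrite !mul1g => -[].
apply: flag_of_inj; apply: eq_in_imset => r _.
by have := eqhk (flag_face (1, false) r); rewrite !permE !act_flag_face.
Qed.

Section Aut.
Variable f : {perm coset_polytope}.
Hypothesis f_aut : f \in polytope_aut coset_polytope.

Lemma aut_le F G : (f F <= f G)%O = (F <= G)%O.
Proof. by move: f_aut; rewrite inE => /forallP/(_ F)/forallP/(_ G)/eqP. Qed.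

Lemma aut_lt F G : (f F < f G)%O = (F < G)%O.
Proof. by rewrite !lt_neqAle aut_le (inj_eq perm_inj). Qed.

End Aut.

(** Along a flag through [F] the images increase strictly, so their ranks grow by at least one at
    each step from rank 0 up. *)
Lemma aut_rank_ge f F : f \in polytope_aut coset_polytope ->
  face_rank F <= face_rank (f F : coset_face).
Proof.
move=> f_aut; have [g /face_mk->] := face_nonempty F.
have [a ->] : exists a, mk_face (face_rank F) g = flag_face a (face_rank F).
  by exists (g, false); rewrite /flag_face /= mul1g if_same.
rewrite face_rank_mk; move: (face_rank F) => [r lr].
elim: r lr => // r IH lr; apply: leq_ltn_trans (IH (ltnW lr)) _.
have : (flag_face a (Ordinal (ltnW lr)) < flag_face a (Ordinal lr))%O.
  exact: flag_face_lt.
by rewrite -(aut_lt f_aut) lt_face => /andP[].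
Qed.

Lemma aut_rank f F : f \in polytope_aut coset_polytope ->
  face_rank (f F : coset_face) = face_rank F.
Proof.
move=> f_aut; apply: val_inj; apply/eqP; rewrite eqn_leq aut_rank_ge // andbT.
by rewrite -{2}[F](permK f) aut_rank_ge // groupV.
Qed.

Definition corr (f : {perm coset_polytope}) a b := forall r, f (flag_face a r) = flag_face b r.

Lemma aut_corr f a : f \in polytope_aut coset_polytope -> exists b, corr f a b.
Proof.
move=> f_aut.
have [|b sub] := @chain_sub_flag (f @: flag_of a).
  apply/'forall_in_forall_inP => _ /imsetP[F Fa ->] _ /imsetP[G Ga ->].
  rewrite /Order.comparable !aut_le //.
  exact: (forall_inP (forall_inP (flag_of_chain a) F Fa) G Ga).
exists b => r; apply/eqP; rewrite -{2}[r](face_rank_mk r a.1).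
have := subsetP sub (f (flag_face a r)); rewrite mem_flag_of aut_rank //; apply.
by apply: imset_f; apply: imset_f.
Qed.

(** The image of the adjacent flag agrees with [b] outside rank [r], so [diamond] leaves [b] and
    [rho r b]; injectivity of [f] excludes [b]. *)
Lemma corr_rho f (r : 'I_5) a b : f \in polytope_aut coset_polytope -> 0 < r < 4 ->
  corr f a b -> corr f (rho r a) (rho r b).
Proof.
move=> f_aut r14 ab; have [c ac] := aut_corr (rho r a) f_aut.
case: (@diamond r b c) => [r' ne|eq_cb|[<- //]].
  by rewrite -ac -ab rho_agree.
have := ac r; rewrite eq_cb -ab => /perm_inj eqr.
by case: (rho_neq r14 eqr).
Qed.

(** Two successive adjacencies multiply [(g, false)] on the left by [y] or by [x^-1]. Commuting with
    adjacency, [f] commutes with left multiplication by everything these generate, and so acts on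
    flags as right multiplication by [k]. *)
Lemma corr_mul_false f k : f \in polytope_aut coset_polytope ->
  corr f (1, false) (k, false) -> forall g e, corr f (g, e) (g * k, e).
Proof.
move=> f_aut f1.
have yP g h : corr f (g, false) (h, false) -> corr f (y * g, false) (y * h, false).
  by move/(corr_rho f_aut (r := o3) isT)/(corr_rho f_aut (r := o2) isT).
have xP g h : corr f (g, false) (h, false) -> corr f (x^-1 * g, false) (x^-1 * h, false).
  rewrite -ys_x -(mulgA y s g) -(mulgA y s h).
  by move/(corr_rho f_aut (r := o1) isT)/(corr_rho f_aut (r := o2) isT).
have gP g : corr f (g, false) (g * k, false).
  have : g \in <<[set x^-1; y]>>.
    have: g \in [set: gT] by rewrite inE.
    rewrite -(rot_gen p); apply/subsetP; rewrite gen_subG; apply/subsetP => h.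
    case/set2P=> ->; last by rewrite mem_gen ?set22.
    by rewrite -groupV mem_gen ?set21.
  have : corr f (g * 1, false) (g * k, false) -> corr f (g, false) (g * k, false).
    by rewrite mulg1.
  move=> H /(gen_closed_ind (P := fun g => forall u v, corr f (u, false) (v, false) ->
    corr f (g * u, false) (g * v, false))) IH; apply: H; apply: IH => //.
  - by move=> u v; rewrite !mul1g.
  - by move=> g' h IHg IHh u v /IHh/IHg; rewrite !mulgA.
  by move=> h /set2P[]-> u v; [apply: xP | apply: yP].
move=> g [] //; exact: (corr_rho f_aut (r := o3) isT (gP g)).
Qed.

(* On flags, an automorphism exchanging the two orbits replaces y by y^-1. *)
Lemma corr_word_true f k (w : seq bool) : f \in polytope_aut coset_polytope ->
  corr f (1, false) (k, true) ->
  corr f (\prod_(c <- w) (if c then s else y), false)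
         (\prod_(c <- w) (if c then s else y^-1) * k, true).
Proof.
move=> f_aut f1; elim: w => [|c w IH]; first by rewrite !big_nil mul1g.
rewrite !big_cons -mulgA; case: c.
  by have /(corr_rho f_aut (r := o3) isT) := corr_rho f_aut (r := o1) isT IH.
by have /(corr_rho f_aut (r := o2) isT) := corr_rho f_aut (r := o3) isT IH.
Qed.

Lemma corr_inj f a b c : corr f a b -> corr f a c -> b = c.
Proof.
by move=> ab ac; apply: flag_of_inj; apply: eq_in_imset => r _; rewrite -ab -ac.
Qed.

(** * Chirality from a word *)

Section Chirality.
Variable w : seq bool.
Hypothesis w1 : \prod_(c <- w) (if c then s else y) = 1.
Hypothesis w_neq1 : \prod_(c <- w) (if c then s else y^-1) != 1.

(** If the base flag went to some [(k, true)], following [w] would return the base flag to itself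
    and force the mirrored word to fix [k], contrary to [w_neq1]. *)
Lemma aut_corr1 f : f \in polytope_aut coset_polytope ->
  exists k, corr f (1, false) (k, false).
Proof.
move=> f_aut; have [[k []] f1] := aut_corr (1, false) f_aut; last by exists k.
have := corr_word_true w f_aut f1; rewrite w1 => /(corr_inj f1)[/esym/eqP].
by rewrite -[X in _ == X]mul1g (inj_eq (mulIg k)) (negbTE w_neq1).
Qed.

Lemma aut_eq : polytope_aut coset_polytope = act_perm @* [set: gT].
Proof.
apply/eqP; rewrite eqEsubset; apply/andP; split; last first.
  by apply/subsetP => _ /morphimP[h _ _ ->]; apply: act_perm_aut.
apply/subsetP => f f_aut; have [k /(corr_mul_false f_aut) fk] := aut_corr1 f_aut.
suff -> : f = act_perm k by apply: mem_morphim; rewrite inE.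
apply/permP => F; rewrite permE; have [g /face_mk->] := face_nonempty F.
have := fk g false (face_rank F); rewrite -act_flag_face /flag_face /= mul1g if_same.
by [].
Qed.

Lemma card_coset_aut : #|polytope_aut coset_polytope| = #|gT|.
Proof. by rewrite aut_eq card_injm ?cardsT //; apply: act_perm_injm. Qed.

Lemma solvable_coset_aut : solvable [set: gT] -> solvable (polytope_aut coset_polytope).
Proof. by rewrite aut_eq; apply: morphim_sol. Qed.

Lemma flag_orbitP g e (Phi : {set coset_polytope}) :
  reflect (exists h, Phi = flag_of (h, e))
    (Phi \in orbit 'P^* (polytope_aut coset_polytope) (flag_of (g, e))).
Proof.
have im h : [set act_perm h F | F in flag_of (g, e)] = flag_of (g * h, e).
  apply/setP => F; apply/imsetP/imsetP => [[_ /imsetP[r _ ->] ->]|[r _ ->]].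
    by exists r; rewrite ?permE ?act_flag_face.
  exists (flag_face (g, e) r); first exact: imset_f.
  by rewrite permE act_flag_face.
apply: (iffP orbitP) => [[f]|[h ->]].
  rewrite aut_eq => /morphimP[h _ _ ->] <-; exists (g * h); exact: im.
exists (act_perm (g^-1 * h)); first exact: act_perm_aut.
by rewrite -[RHS]/(flag_of (h, e)) -{2}[h](mulKVg g); apply: im.
Qed.

(** The boolean separates the two orbits: right multiplication keeps it and every adjacency flips
    it. *)
Lemma coset_chiral : chiral coset_polytope.
Proof.
have or_eq g e : orbit 'P^* (polytope_aut coset_polytope) (flag_of (g, e)) =
    orbit 'P^* (polytope_aut coset_polytope) (flag_of (1, e)).
  by apply/orbit_eqP/flag_orbitP; exists g.
split.
  have -> : orbit 'P^* (polytope_aut coset_polytope) @: flags coset_polytope =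
      [set orbit 'P^* (polytope_aut coset_polytope) (flag_of (1, e)) | e : bool].
    apply/setP => O; apply/imsetP/imsetP => [[Phi]|[e _ ->]].
      by rewrite inE => /flagP[[g e] ->] ->; exists e.
    by exists (flag_of (1, e)); rewrite // inE; apply: flag_of_flag.
  rewrite card_imset ?card_bool // => e e' /setP/(_ (flag_of (1, e))).
  rewrite orbit_refl => /esym/flag_orbitP[h].
  by move/flag_of_inj => [].
move=> Phi Psi; rewrite !inE => /flagP[[g e] ->] /flagP[b ->] /adjacentP[r r14 ->].
apply/negP => /flag_orbitP[h] /flag_of_inj.
by case: r r14 => [[|[|[|[|[|?]]]]] ?] //= _ []; case: e.
Qed.

End Chirality.

(** * The Schlaefli type *)

Lemma polygonal_section_of k (F G : coset_face) (V E : 'I_k -> coset_face) r :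
    [/\ face_rank F = r :> nat, (forall i, face_rank (V i) = r.+1 :> nat),
        (forall i, face_rank (E i) = r.+2 :> nat) & face_rank G = r.+3 :> nat] ->
    injective V -> injective E -> (F <= G)%O ->
    (forall i, (F <= V i)%O) -> (forall i, (V i <= E i)%O) -> (forall i, (E i <= G)%O) ->
    (forall H, (F <= H <= G)%O -> face_rank H = r.+1 :> nat -> exists i, H = V i) ->
    (forall H, (F <= H <= G)%O -> face_rank H = r.+2 :> nat -> exists i, H = E i) ->
    (forall i j, (V i <= E j)%O = (i == j) || (i == ordS j)) ->
  polygonal_section k F G.
Proof.
case=> rF rV rE rG injV injE leFG leFV leVE leEG surV surE leP.
have leFE i : (F <= E i)%O := le_trans (leFV i) (leVE i).
have leVG i : (V i <= G)%O := le_trans (leVE i) (leEG i).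
have rank_le H K : (H <= K)%O -> face_rank H <= face_rank K.
  by rewrite le_eqVlt lt_face => /predU1P[->//|/andP[/ltnW]].
have not_le H K : face_rank K < face_rank H -> (H <= K)%O = false.
  by rewrite ltnNge => ltr; apply: contraNF ltr => /rank_le.
have same_le H K : face_rank H = face_rank K :> nat -> (H <= K)%O = (H == K).
  by move=> eqr; rewrite le_eqVlt lt_face eqr ltnn orbF.
pose f (c : polygon_face k) : coset_face :=
  match c with
  | PolygonBottom => F | PolygonVertex i => V i | PolygonEdge i => E i | PolygonTop => G
  end.
have f_le c d : (f c <= f d)%O = polygon_le c d.
  case: c d => [|i|i|] [|j|j|] /=; rewrite ?lexx ?leFV ?leFE ?leVG ?leEG //;
    try by rewrite not_le ?rF ?rV ?rE ?rG.
  - by rewrite same_le ?rV // (inj_eq injV).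
  - by rewrite same_le ?rE // (inj_eq injE).
- by rewrite not_le // rF rG; do 2!apply: leqW.
exists f; split=> // [c d eqf|H].
  have : polygon_le c d && polygon_le d c by rewrite -!f_le eqf lexx.
  by case: c d {eqf} => [|i|i|] [|j|j|] //=; rewrite ?andbF //; move/andP=> [/eqP->].
rewrite inE; split=> [FHG|[c ->]]; last first.
  by rewrite -[F]/(f (PolygonBottom k)) -[G]/(f (PolygonTop k)) !f_le; case: c.
have /andP[leFH leHG] := FHG.
have := rank_le _ _ leHG; have := rank_le _ _ leFH; rewrite rF rG.
rewrite leq_eqVlt => /predU1P[eqr _|].
  exists (PolygonBottom k); apply/esym/eqP; rewrite -same_le //=.
  by rewrite rF.
rewrite leq_eqVlt => /predU1P[/esym/(surV _ FHG)[i ->] _|]; first by exists (PolygonVertex i).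
rewrite leq_eqVlt => /predU1P[/esym/(surE _ FHG)[i ->] _|ltr ler]; first by exists (PolygonEdge i).
exists (PolygonTop k); apply/eqP; rewrite -same_le //= rG.
by apply/eqP; rewrite eqn_leq ler ltr.
Qed.

Lemma expg_ord_inj (u : gT) (i j : 'I_#[u]) : (u ^+ i == u ^+ j) = (i == j).
Proof. by rewrite eq_expg_mod_order !modn_small. Qed.

Lemma expg_ordS (u : gT) (j : 'I_#[u]) : u ^+ ordS j = u * u ^+ j.
Proof. by rewrite /= -expg_mod_order modn_mod expg_mod_order expgS. Qed.

Lemma le_mk_face_coset (r r' : 'I_5) g H : r < r' -> face_rank H = r ->
  (H <= mk_face r' g)%O -> exists2 c, H = mk_face r c & c * g^-1 \in face_stab r'.
Proof.
move=> ltr rH; rewrite le_face => /face_leP[eqH|[_ [c [defH /eqP]]]].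
  by move: ltr; rewrite -rH eqH ltnn.
rewrite face_rank_mk eq_sym mk_face_eq rH in defH * => cg.
by exists c.
Qed.

Lemma face_polygon g : polygonal_section #[x] (mk_face ord0 g) (mk_face o3 g).
Proof.
(* The inverse gives the orientation of [polygon_le]: as [s = y^-1 * x^-1], the far end
   [s * u ^+ j * g] of edge [j] lies on the vertex of [u ^+ j.+1 * g]. *)
set u := x^-1; have ux : <[u]> = <[x]> by rewrite cycleV.
have -> : #[x] = #[u] by rewrite orderV.
pose V (i : 'I_#[u]) := mk_face o1 (u ^+ i * g).
pose E (i : 'I_#[u]) := mk_face o2 (u ^+ i * g).
have ui i : u ^+ i \in <[x]> by rewrite -ux mem_cycle.
have injV : injective V.
  move=> i j /eqP; rewrite mk_face_eq /= invMg mulgA mulgK => uy.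
  apply/eqP; rewrite -expg_ord_inj eq_mulgV1; apply/eqP.
  by apply: mem_cycle_xy_eq1; rewrite // groupM ?groupV.
apply: (@polygonal_section_of _ _ _ V E 0) => //.
- move=> i j /eqP; rewrite mk_face_eq /= invMg mulgA mulgK mem_cycle_s => /orP[|/eqP us].
    by rewrite -eq_mulgV1 expg_ord_inj => /eqP.
  by case/negP: s_notin_x; rewrite -us groupM ?groupV.
- exact: mk_face0_le.
- by move=> i; apply: mk_face0_le.
- by move=> i; apply: mk_face_le.
- move=> i; have /eqP-> : mk_face o3 g == mk_face o3 (u ^+ i * g).
    by rewrite mk_face_eq /= invMg mulgA mulgV mul1g groupV.
  exact: mk_face_le.
- move=> H /andP[_ leH] /(@val_inj _ _ _ _ o1) rH.
  have [c -> /=] := le_mk_face_coset (r := o1) (r' := o3) isT rH leH.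
  rewrite -ux => /cyclePmin[i lti eqc]; exists (Ordinal lti).
  by rewrite /V /= -eqc mulgKV.
- move=> H /andP[_ leH] /(@val_inj _ _ _ _ o2) rH.
  have [c -> /=] := le_mk_face_coset (r := o2) (r' := o3) isT rH leH.
  rewrite -ux => /cyclePmin[i lti eqc]; exists (Ordinal lti).
  by rewrite /E /= -eqc mulgKV.
move=> i j; apply/idP/orP.
  move/(@le_mk_face_coset o1 o2 _ (V i) isT erefl) => [c /eqP].
  rewrite mk_face_eq /= mem_cycle_s => ic; case/orP.
    rewrite -eq_mulgV1 => /eqP eqc; left; apply/eqP/injV/eqP.
    by rewrite mk_face_eq /= -eqc.
  move/eqP=> cs; right; rewrite -expg_ord_inj expg_ordS eq_mulgV1; apply/eqP.
  apply: mem_cycle_xy_eq1; first by rewrite -expgS groupM ?groupV.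
  have eqc : c = s * u ^+ j * g by rewrite -mulgA -cs mulgKV.
  have su : s^-1 = u^-1 * y by rewrite sV invgK.
  by move: ic; rewrite eqc invMg mulgA mulgK invMg su !mulgA groupMr ?cycle_id // invMg mulgA.
case=> /eqP->; first exact: mk_face_le.
have -> : V (ordS j) = mk_face o1 (s * u ^+ j * g).
  apply/eqP; rewrite mk_face_eq /= expg_ordS -(mulgA s) -(mulgA u).
  by rewrite -mulgA invMg mulKVg sV mulKg cycle_id.
have -> : E j = mk_face o2 (s * u ^+ j * g).
  by apply/eqP; rewrite mk_face_eq /= -(mulgA s) invMg mulKVg groupV cycle_id.
exact: mk_face_le.
Qed.

Lemma vertex_polygon g : polygonal_section #[y] (mk_face o1 g) (mk_face ord_max g).
Proof.
(* Again for orientation: [s * u ^+ j.+1 * g = x * u ^+ j * g], so edge [j + 1] lies on the 2-face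
   [j]. *)
set u := y^-1; have uy : <[u]> = <[y]> by rewrite cycleV.
have -> : #[y] = #[u] by rewrite orderV.
pose V (i : 'I_#[u]) := mk_face o2 (u ^+ i * g).
pose E (i : 'I_#[u]) := mk_face o3 (u ^+ i * g).
have ui i : u ^+ i \in <[y]> by rewrite -uy mem_cycle.
have gE i : mk_face o1 g = mk_face o1 (u ^+ i * g).
  by apply/eqP; rewrite mk_face_eq /= invMg mulgA mulgV mul1g groupV.
have injE : injective E.
  move=> i j /eqP; rewrite mk_face_eq /= invMg mulgA mulgK => ux.
  apply/eqP; rewrite -expg_ord_inj eq_mulgV1; apply/eqP.
  by apply: mem_cycle_xy_eq1; rewrite // groupM ?groupV.
have mem_y c (r : 'I_5) : o1 < r -> (mk_face o1 g <= mk_face r c)%O ->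
    exists2 h, mk_face r c = mk_face r h & h * g^-1 \in <[y]>.
  move=> ltr; rewrite le_face => /face_leP[eqF|[_ [h [/esym/eqP]]]].
    by move: ltr; rewrite -(face_rank_mk r c) -eqF ltnn.
  by rewrite !face_rank_mk mk_face_eq => hg ->; exists h.
have surj H (r : 'I_5) : o1 < r -> (mk_face o1 g <= H)%O -> face_rank H = r ->
    exists i : 'I_#[u], H = mk_face r (u ^+ i * g).
  move=> ltr leH rH; have [c defH] := face_nonempty H.
  move: leH; rewrite (face_mk defH) rH => /(mem_y _ _ ltr)[h -> ].
  rewrite -uy => /cyclePmin[i lti eqh]; exists (Ordinal lti).
  by rewrite /= -eqh mulgKV.
apply: (@polygonal_section_of _ _ _ V E 1) => //.
- move=> i j /eqP; rewrite mk_face_eq /= invMg mulgA mulgK mem_cycle_s => /orP[|/eqP us].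
    by rewrite -eq_mulgV1 expg_ord_inj => /eqP.
  by case/negP: s_notin_y; rewrite -us groupM ?groupV.
- exact: le_mk_face4.
- by move=> i; rewrite (gE i); apply: mk_face_le.
- by move=> i; apply: mk_face_le.
- by move=> i; apply: le_mk_face4.
- by move=> H /andP[leH _] /(@val_inj _ _ _ _ o2); apply: surj.
- by move=> H /andP[leH _] /(@val_inj _ _ _ _ o3); apply: surj.
move=> i j; apply/idP/orP.
  move/(@le_mk_face_coset o2 o3 _ (V i) isT erefl) => [c /eqP].
  rewrite eq_sym mk_face_eq /= mem_cycle_s => /orP[|/eqP ci cj].
    rewrite -eq_mulgV1 => /eqP-> cj; left; apply/eqP/injE/eqP.
    by rewrite mk_face_eq.
  right; rewrite -expg_ord_inj expg_ordS eq_mulgV1; apply/eqP.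
  apply: mem_cycle_xy_eq1; last by rewrite -expgS groupM ?groupV.
  have eqc : c = s * u ^+ i * g by rewrite -mulgA -ci mulgKV.
  move: cj; rewrite eqc invMg mulgA mulgK -!mulgA groupMl ?cycle_id // => hx.
  have hy : y * (u ^+ i * u ^- j) = 1.
    by apply: mem_cycle_xy_eq1; rewrite // groupM ?cycle_id // groupM ?groupV.
  have -> : u ^+ i * (u * u ^+ j)^-1 = y^-1 * (y * (u ^+ i * u ^- j)) * y.
    by rewrite mulKg invMg invgK mulgA.
  by rewrite hy mulg1 mulVg group1.
case=> /eqP->; first exact: mk_face_le.
have -> : E j = mk_face o3 (s * u ^+ ordS j * g).
  apply/eqP; rewrite eq_sym mk_face_eq /= expg_ordS.
  by rewrite (mulgA s u) mulgK -(mulgA x) mulgK cycle_id.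
have -> : V (ordS j) = mk_face o2 (s * u ^+ ordS j * g).
  by apply/eqP; rewrite mk_face_eq /= -(mulgA s) invMg mulKVg groupV cycle_id.
exact: mk_face_le.
Qed.

Lemma coset_type : has_type coset_polytope [:: #[x]; #[y]].
Proof.
split=> // i F G; case: i => [|[|[|i]]] // _ /eqP rF /eqP rG.
  have {}rF : face_rank F = ord0.
    by apply: val_inj; move: rF; rewrite -(inj_eq (addIr 1%R)) subrK => /eqP[].
  have {}rG : face_rank G = o3.
    by apply: val_inj; move: rG; rewrite -(inj_eq (addIr 1%R)) subrK => /eqP[].
  have [g /face_mk->] := face_nonempty G; have [h /face_mk->] := face_nonempty F.
  move=> _; rewrite rF rG.
  have /eqP-> : mk_face ord0 h == mk_face ord0 g by rewrite mk_face_eq inE.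
  exact: face_polygon.
have {}rF : face_rank F = o1.
  by apply: val_inj; move: rF; rewrite -(inj_eq (addIr 1%R)) subrK => /eqP[].
have {}rG : face_rank G = ord_max.
  by apply: val_inj; move: rG; rewrite -(inj_eq (addIr 1%R)) subrK => /eqP[].
have [g /face_mk->] := face_nonempty F; have [h /face_mk->] := face_nonempty G.
move=> _; rewrite rF rG.
have /eqP-> : mk_face ord_max h == mk_face ord_max g by rewrite mk_face_eq inE.
exact: vertex_polygon.
Qed.

End CosetFaces.

(** * Polytopes from subgroups and from quotients *)

Theorem chiral_polytope_of_group (gT : finGroupType) (G : {group gT}) (x y : gT) (w : seq bool) :
    x * y * (x * y) = 1 -> <[x]> :&: <[y]> = 1 -> x != 1 -> y != 1 ->
    <<[set x; y]>> = G -> solvable G ->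
    \prod_(c <- w) (if c then x * y else y) = 1 ->
    \prod_(c <- w) (if c then x * y else y^-1) != 1 ->
  exists P : polytope 3, [/\ chiral P, has_type P [:: #[x]; #[y]],
    solvable (polytope_aut P) & #|polytope_aut P| = #|G|].
Proof.
move=> xy2 tixy x1 y1 genG solG w1 wn1.
have Gx : x \in G by rewrite -genG mem_gen ?set21.
have Gy : y \in G by rewrite -genG mem_gen ?set22.
set u := subg G x; set v := subg G y.
have valu : sgval u = x by apply: subgK.
have valv : sgval v = y by apply: subgK.
have uv2 : u * v * (u * v) = 1 by apply: val_inj; rewrite /= valu valv.
have tiuv : <[u]> :&: <[v]> = 1.
  by rewrite -!morphim_cycle // -injmI ?injm_subg // tixy morphim1.
have u1 : u != 1 by rewrite morph_injm_eq1 ?injm_subg.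
have v1 : v != 1 by rewrite morph_injm_eq1 ?injm_subg.
have genuv : <<[set u; v]>> = [set: subg_of G].
  rewrite -im_subg -[X in _ @* X]genG morphim_gen ?morphimU ?morphim_set1 //.
  by rewrite subUset !sub1set Gx.
pose R := RotationPair uv2 tiuv u1 v1 genuv.
(* The boolean [e] selects the word or its mirror image, so one computation transfers both. *)
have val_prod (e : bool) : sgval (\prod_(c <- w) (if c then u * v else if e then v^-1 else v)) =
    \prod_(c <- w) (if c then x * y else if e then y^-1 else y).
  rewrite (big_morph sgval (id1 := 1) (op1 := mulg)) //; apply: eq_bigr => c _.
  by case: c; [|case: e]; rewrite /= ?valu ?valv.
have w1' : \prod_(c <- w) (if c then rot_x R * rot_y R else rot_y R) = 1.
  by apply: val_inj; have /= -> := val_prod false.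
have wn1' : \prod_(c <- w) (if c then rot_x R * rot_y R else (rot_y R)^-1) != 1.
  by apply: contraNneq wn1 => /= eq1; rewrite -(val_prod true) /= eq1.
exists (coset_polytope R); split.
- exact: coset_chiral w1' wn1'.
- have -> : #[x] = #[u] by rewrite order_injm ?injm_subg.
  have -> : #[y] = #[v] by rewrite order_injm ?injm_subg.
  exact: coset_type R.
- by apply: solvable_coset_aut w1' wn1' _; rewrite -im_subg morphim_sol.
by rewrite (card_coset_aut w1' wn1') -cardsT -im_subg card_injm ?injm_subg.
Qed.

(** The condition on the products [x ^+ i * y ^+ j] in [N] does three jobs: it keeps the orders [p]
    and [q] in the quotient and makes the two cyclic images meet trivially. *)
Theorem chiral_polytope_of_quotient (gT : finGroupType) (G N : {group gT}) (x y : gT)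
    (p q : nat) (w : seq bool) :
    (1 < p)%N -> (1 < q)%N -> (x * y) ^+ 2 = 1 -> x ^+ p = 1 -> y ^+ q = 1 ->
    (forall i j, x ^+ i * y ^+ j \in N -> (p %| i) && (q %| j)) ->
    <<[set x; y]>> = G -> N <| G -> solvable G ->
    \prod_(c <- w) (if c then x * y else y) = 1 ->
    \prod_(c <- w) (if c then x * y else y^-1) \notin N ->
  exists P : polytope 3, [/\ chiral P, has_type P [:: p; q],
    solvable (polytope_aut P) & (#|polytope_aut P| * #|N|)%N = #|G|].
Proof.
move=> p1 q1 xy2 xp yq tiN genG nsNG solG w1 wnN.
have nNG := normal_norm nsNG.
have nNx : x \in 'N(N) by apply: (subsetP nNG); rewrite -genG mem_gen ?set21.
have nNy : y \in 'N(N) by apply: (subsetP nNG); rewrite -genG mem_gen ?set22.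
set u := coset N x; set v := coset N y.
have uvN i j : u ^+ i * v ^+ j = 1 -> (p %| i) && (q %| j).
  rewrite -!morphX // -morphM ?groupX // => /coset_idr H; apply: tiN; apply: H.
  by rewrite groupM ?groupX.
have ordu : #[u] = p.
  apply/eqP; rewrite eqn_dvd order_dvdn -morphX // xp morph1 eqxx /=.
  by have /andP[] : (p %| #[u]) && (q %| 0) by apply: uvN; rewrite expg_order mul1g.
have ordv : #[v] = q.
  apply/eqP; rewrite eqn_dvd order_dvdn -morphX // yq morph1 eqxx /=.
  by have /andP[] : (p %| 0) && (q %| #[v]) by apply: uvN; rewrite expg_order mul1g.
rewrite -ordu -ordv.
have [||||||||P [chP tP solP cardP]] :=
  @chiral_polytope_of_group _ (G / N)%G u v w.
- by rewrite -morphM // -morphM ?groupM // -expg2 xy2 morph1.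
- apply/trivgP/subsetP => _ /setIP[/cycleP[i ->] /cycleP[j eqij]].
  (* The exponent [#[v].-1 * j] stands for [- j], since [uvN] takes natural exponents only. *)
  have /uvN/andP[] : u ^+ i * v ^+ (#[v].-1 * j) = 1.
    rewrite eqij -expgD -[X in (X + _)%N]mul1n -mulnDl add1n prednK ?order_gt0 //.
    by rewrite expgM expg_order expg1n.
  by rewrite -ordu order_dvdn => /eqP->; rewrite inE.
- by rewrite -order_gt1 ordu.
- by rewrite -order_gt1 ordv.
- rewrite /= -genG quotient_gen ?quotientU ?quotient_set1 //.
  by rewrite subUset !sub1set nNx.
- exact: quotient_sol.
- have <- : coset N (\prod_(c <- w) (if c then x * y else y)) =
      \prod_(c <- w) (if c then u * v else v).
    rewrite morph_prod => [|c _]; last by case: c; rewrite ?groupM.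
    by apply: eq_bigr => c _; case: c; rewrite ?morphM.
  by rewrite w1 morph1.
- have <- : coset N (\prod_(c <- w) (if c then x * y else y^-1)) =
      \prod_(c <- w) (if c then u * v else v^-1).
    rewrite morph_prod => [|c _]; last by case: c; rewrite ?groupM ?groupV.
    by apply: eq_bigr => c _; case: c; rewrite ?morphM ?morphV.
  apply: contra wnN => /eqP/coset_idr; apply; apply: group_prod => c _.
  by case: c; rewrite ?groupM ?groupV.
exists P; split=> //.
by rewrite cardP card_quotient // mulnC Lagrange ?normal_sub.
Qed.

(** * Affine groups of dimension 4 over Z/8m *)

(* [(b, t)] is the map v |-> (-1)^b v + t; products are composed from left to right. *)
Definition dihedral (A : finZmodType) : Type := bool * A.
HB.instance Definition _ (A : finZmodType) := Finite.on (dihedral A).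

Section Dihedral.
Variable A : finZmodType.
Implicit Types d : dihedral A.

Definition signr (b : bool) (t : A) : A := if b then (- t)%R else t.
Definition dih_mul d e : dihedral A := (d.1 (+) e.1, (signr e.1 d.2 + e.2)%R).
Definition dih_one : dihedral A := (false, 0%R).
Definition dih_inv d : dihedral A := (d.1, signr (~~ d.1) d.2).

Lemma dih_mulA : associative dih_mul.
Proof.
move=> [b t] [b' t'] [b'' t'']; rewrite /dih_mul /= addbA; congr (_, _).
by rewrite addrA; congr (_ + _)%R; case: b' b'' => [] []; rewrite //= ?opprD ?opprK.
Qed.

Lemma dih_mul1 : left_id dih_one dih_mul.
Proof. by move=> [[] t]; rewrite /dih_mul /signr /= ?oppr0 add0r. Qed.

Lemma dih_mulV : left_inverse dih_one dih_inv dih_mul.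
Proof. by move=> [[] t]; rewrite /dih_mul /dih_inv /signr /= ?addNr ?addrN. Qed.

HB.instance Definition _ := Finite_isGroup.Build (dihedral A) dih_mulA dih_mul1 dih_mulV.

Definition dih (b : bool) (t : A) : dihedral A := (b, t).

Lemma dihM b t b' t' : dih b t * dih b' t' = dih (b (+) b') (signr b' t + t')%R.
Proof. by []. Qed.

Lemma dih_eq b t b' t' : (dih b t == dih b' t') = (b == b') && (t == t').
Proof. by []. Qed.

Lemma dihP d : exists b t, d = dih b t. Proof. by case: d => b t; exists b, t. Qed.

End Dihedral.

(* [(r, f)] sends the i-th coordinate to position i + r after applying [f i] to it; products
   are again composed from left to right. *)
Definition wreath4 (D : finGroupType) : Type := 'I_4 * {ffun 'I_4 -> D}.
HB.instance Definition _ (D : finGroupType) := Finite.on (wreath4 D).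

Section Wreath.
Variable D : finGroupType.
Implicit Types g h : wreath4 D.

Definition wr_mul g h : wreath4 D :=
  ((g.1 + h.1)%R, [ffun i => g.2 i * h.2 (i + g.1)%R]).
Definition wr_one : wreath4 D := (0%R, [ffun => 1]).
Definition wr_inv g : wreath4 D := ((- g.1)%R, [ffun i => (g.2 (i - g.1)%R)^-1]).

Lemma wr_mulA : associative wr_mul.
Proof.
move=> [r f] [q k] [u l]; rewrite /wr_mul /= addrA; congr (_, _).
by apply/ffunP => i; rewrite !ffunE mulgA addrA.
Qed.

Lemma wr_mul1 : left_id wr_one wr_mul.
Proof.
move=> [r f]; rewrite /wr_mul /= add0r; congr (_, _).
by apply/ffunP => i; rewrite !ffunE mul1g addr0.
Qed.

Lemma wr_mulV : left_inverse wr_one wr_inv wr_mul.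
Proof.
move=> [r f]; rewrite /wr_mul /wr_inv /= addNr; congr (_, _).
by apply/ffunP => i; rewrite !ffunE mulVg.
Qed.

HB.instance Definition _ := Finite_isGroup.Build (wreath4 D) wr_mulA wr_mul1 wr_mulV.

(** Any natural [r] is accepted and reduced modulo 4 by [inZp], so the product rules below can add
    rotations freely. The default of [nth] is never reached. *)
Definition wel (r : nat) (d0 d1 d2 d3 : D) : wreath4 D :=
  (inZp r, [ffun i : 'I_4 => nth 1 [:: d0; d1; d2; d3] i]).

Lemma ord4_ind (P : 'I_4 -> Prop) :
  P (inZp 0) -> P (inZp 1) -> P (inZp 2) -> P (inZp 3) -> forall i, P i.
Proof.
move=> P0 P1 P2 P3 i; rewrite -[i]valZpK.
by case: i => [[|[|[|[|?]]]] ?].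
Qed.

Lemma welP g : exists r : 'I_4,
  g = wel r (g.2 (inZp 0)) (g.2 (inZp 1)) (g.2 (inZp 2)) (g.2 (inZp 3)).
Proof.
exists g.1; case: g => r f; rewrite /wel /= valZpK; congr (_, _).
by apply/ffunP; apply: ord4_ind; rewrite ffunE.
Qed.

Lemma wel_mul0 q d0 d1 d2 d3 e0 e1 e2 e3 :
  wel 0 d0 d1 d2 d3 * wel q e0 e1 e2 e3 = wel q (d0 * e0) (d1 * e1) (d2 * e2) (d3 * e3).
Proof.
congr (_, _); first by apply: val_inj; rewrite /= add0n modn_mod.
by apply/ffunP; apply: ord4_ind; rewrite !ffunE.
Qed.

Lemma wel_mul1 q d0 d1 d2 d3 e0 e1 e2 e3 :
  wel 1 d0 d1 d2 d3 * wel q e0 e1 e2 e3 = wel q.+1 (d0 * e1) (d1 * e2) (d2 * e3) (d3 * e0).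
Proof.
congr (_, _); first by apply: val_inj; rewrite /= modnDmr add1n.
by apply/ffunP; apply: ord4_ind; rewrite !ffunE.
Qed.

Lemma wel_mul2 q d0 d1 d2 d3 e0 e1 e2 e3 :
  wel 2 d0 d1 d2 d3 * wel q e0 e1 e2 e3 = wel q.+2 (d0 * e2) (d1 * e3) (d2 * e0) (d3 * e1).
Proof.
congr (_, _); first by apply: val_inj; rewrite /= modnDmr.
by apply/ffunP; apply: ord4_ind; rewrite !ffunE.
Qed.

Lemma wel_mul3 q d0 d1 d2 d3 e0 e1 e2 e3 :
  wel 3 d0 d1 d2 d3 * wel q e0 e1 e2 e3 = wel q.+3 (d0 * e3) (d1 * e0) (d2 * e1) (d3 * e2).
Proof.
congr (_, _); first by apply: val_inj; rewrite /= modnDmr.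
by apply/ffunP; apply: ord4_ind; rewrite !ffunE.
Qed.

Lemma wel_eq r d0 d1 d2 d3 q e0 e1 e2 e3 :
  (wel r d0 d1 d2 d3 == wel q e0 e1 e2 e3) =
  [&& r == q %[mod 4], d0 == e0, d1 == e1, d2 == e2 & d3 == e3].
Proof.
apply/eqP/and5P => [[/eqP rq /ffunP fE]|[rq /eqP-> /eqP-> /eqP-> /eqP->]].
  have := fE (inZp 0); have := fE (inZp 1); have := fE (inZp 2); have := fE (inZp 3).
  by rewrite !ffunE /= => -> -> -> ->.
by congr (_, _); apply/val_inj/eqP.
Qed.

Lemma wel1 : 1 = wel 0 1 1 1 1.
Proof.
rewrite -[LHS]/wr_one /wr_one /wel; congr (_, _); first exact: val_inj.
by apply/ffunP; apply: ord4_ind; rewrite !ffunE.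
Qed.

End Wreath.

(* Integral lifts of the elements, on which identities between words are decided by
   computation, uniformly in m. *)
Definition zdih : Type := bool * int.
Definition zword : Type := nat * (zdih * zdih * zdih * zdih).
Definition zdih_mul (a b : zdih) : zdih :=
  (a.1 (+) b.1, ((if b.1 then - a.2 else a.2) + b.2)%R).

Notation codeword := (bool * bool * bool * bool)%type.

(** * The rotation group modulo 8m and its words *)

Section Lattice.
Variable m : nat.
Hypothesis m_gt0 : 0 < m.
Notation n := (8 * m)%N.
Notation Zn := 'Z_n.
Notation W := (wreath4 (dihedral Zn)).
Notation d b t := (@dih Zn b t%R).

Lemma wel_one : 1 = wel 0 (d false 0) (d false 0) (d false 0) (d false 0).
Proof. exact: wel1. Qed.

Definition zD (a : zdih) : dihedral Zn := d a.1 a.2%:~R.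

Definition zmul (a b : zword) : zword :=
  let: (r, (a0, a1, a2, a3)) := a in let: (q, (b0, b1, b2, b3)) := b in
  let: (c0, c1, c2, c3) := match r with
    | 0 => (b0, b1, b2, b3) | 1 => (b1, b2, b3, b0)
    | 2 => (b2, b3, b0, b1) | _ => (b3, b0, b1, b2)
    end in
  (((r + q) %% 4)%N, (zdih_mul a0 c0, zdih_mul a1 c1, zdih_mul a2 c2, zdih_mul a3 c3)).

Lemma zmul_lt4 a b : (zmul a b).1 < 4.
Proof.
case: a b => r [[[? ?] ?] ?] [q [[[? ?] ?] ?]].
by case: r => [|[|[|r]]] /=; rewrite ltn_mod.
Qed.

Definition zW (a : zword) : W :=
  let: (r, (a0, a1, a2, a3)) := a in wel r (zD a0) (zD a1) (zD a2) (zD a3).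

Lemma zD_mul a b : zD (zdih_mul a b) = zD a * zD b.
Proof.
case: a b => b t [b' t']; rewrite /zD dihM /= /signr.
by congr (dih _ _); rewrite intrD; case: b'; rewrite ?mulrNz.
Qed.

Lemma wel_mod r d0 d1 d2 d3 : wel (r %% 4) d0 d1 d2 d3 = wel r d0 d1 d2 d3 :> W.
Proof. by apply/eqP; rewrite wel_eq modn_mod !eqxx. Qed.

(** The bound on [a.1] is needed because [zmul] permutes the coordinates for every rotation above 2
    as it does for 3. *)
Lemma zW_mul a b : a.1 < 4 -> zW (zmul a b) = zW a * zW b.
Proof.
case: a b => r [[[a0 a1] a2] a3] [q [[[b0 b1] b2] b3]] /=.
case: r => [|[|[|[|r]]]] //= _; rewrite wel_mod !zD_mul.
- by rewrite wel_mul0.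
- by rewrite wel_mul1.
- by rewrite wel_mul2.
by rewrite wel_mul3.
Qed.

Definition zone : zword := (0, ((false, 0%R), (false, 0%R), (false, 0%R), (false, 0%R))).

Lemma zW_one : zW zone = 1. Proof. by rewrite wel_one. Qed.

Lemma zW_prod (I : Type) (w : seq I) (F : I -> zword) :
    all (fun c => (F c).1 < 4) w ->
  \prod_(c <- w) zW (F c) = zW (foldr (fun c => zmul (F c)) zone w).
Proof.
elim: w => [|c w IH] /=; first by rewrite big_nil -zW_one.
by case/andP=> lt4 /IH{}IH; rewrite big_cons IH zW_mul.
Qed.

Lemma zW_exp a k : a.1 < 4 -> zW a ^+ k = zW (iter k (zmul a) zone).
Proof.
by move=> lt4; elim: k => [|k IH] /=; [rewrite expg0 -zW_one | rewrite expgS IH zW_mul].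
Qed.

(** In the basis 1, zeta, zeta^2, zeta^3 multiplication by zeta shifts the coordinates, with a sign
    at the last because zeta^4 = -1. *)
Definition zy : zword := (1%N, ((false, 0%R), (false, 0%R), (false, 0%R), (true, 0%R))).
Definition zyV : zword := (3%N, ((true, 0%R), (false, 0%R), (false, 0%R), (false, 0%R))).
Definition zs : zword := (0%N, ((false, 0%R), (true, 0%R), (true, 1%R), (true, 1%R))).
Definition zx : zword := (3%N, ((true, 0%R), (true, 0%R), (true, 1%R), (true, 1%R))).

Notation gx := (zW zx).
Notation gy := (zW zy).
Notation gs := (zW zs).

Lemma gyV : gy^-1 = zW zyV.
Proof. by apply/eqP; rewrite eq_invg_mul -zW_mul // -zW_one; apply/eqP. Qed.

Lemma gx_gy : gx * gy = gs.
Proof. by rewrite -zW_mul. Qed.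

Lemma gy8 : gy ^+ 8 = 1.
Proof. by rewrite zW_exp // -zW_one. Qed.

Lemma gs2 : gs ^+ 2 = 1.
Proof. by rewrite zW_exp // -zW_one. Qed.

Lemma gx4 : gx ^+ 4 = 1.
Proof. by rewrite zW_exp // -zW_one. Qed.

(* Found by a computer search over words s y^(k1) s y^(k2) etc. *)
Definition chiral_word : seq bool :=
  (true :: nseq 1 false) ++ (true :: nseq 3 false) ++ (true :: nseq 7 false) ++
  (true :: nseq 5 false) ++ (true :: nseq 2 false) ++ (true :: nseq 2 false).

Lemma chiral_word_eq1 : \prod_(c <- chiral_word) (if c then gx * gy else gy) = 1.
Proof.
rewrite gx_gy (eq_bigr (fun c => zW (if c then zs else zy))) => [|[] //].
by rewrite zW_prod // -zW_one; congr zW; vm_compute.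
Qed.

Lemma chiral_word_mirror : \prod_(c <- chiral_word) (if c then gx * gy else gy^-1) =
  zW (0%N, ((false, 2%R), (false, 2%R), (false, (-2)%R), (false, 2%R))).
Proof.
rewrite gx_gy gyV (eq_bigr (fun c => zW (if c then zs else zyV))) => [|[] //].
by rewrite zW_prod //; congr zW; vm_compute.
Qed.

(** * Membership by parity, and the order of the group *)

Lemma n_gt1 : 1 < n. Proof. by rewrite -(prednK m_gt0) mulnS. Qed.

Lemma card_Zn : #|Zn| = n. Proof. by rewrite card_ord Zp_cast ?n_gt1. Qed.

(** Parity of residues is compatible with addition because the modulus 8m is even. *)
Definition zodd (t : Zn) : bool := odd (val t).

Lemma zodd_nat k : zodd k%:R%R = odd k.
Proof.
by rewrite /zodd /= val_Zp_nat ?n_gt1 // odd_mod // oddM.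
Qed.

Lemma zoddD t u : zodd (t + u)%R = zodd t (+) zodd u.
Proof. by rewrite -[t in LHS]natr_Zp -[u in LHS]natr_Zp -natrD zodd_nat oddD. Qed.

Lemma zodd0 : zodd 0%R = false. Proof. exact: (zodd_nat 0). Qed.

Lemma zoddN t : zodd (- t)%R = zodd t.
Proof.
by have := zoddD (- t)%R t; rewrite addNr zodd0; case: zodd; case: zodd.
Qed.

Lemma zodd_signr b t : zodd (signr b t) = zodd t.
Proof. by case: b; rewrite /= ?zoddN. Qed.

(* y^r carries a sign at the positions i with 4 <= r + i; the sign of g is counted relative
   to it. *)
Definition twisted_sign (g : W) (i : 'I_4) : bool := (g.2 i).1 (+) (4 <= g.1 + i).

(* The translation part modulo 2 is a cocycle in the linear part, and it vanishes on y;
   this condition characterizes the elements of the group. *)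
Definition parity_ok (g : W) : bool :=
  [forall i, zodd (g.2 i).2 == twisted_sign g (i + inZp 1)%R (+) twisted_sign g (i + inZp 2)%R].

Lemma mulW1 (g h : W) : (g * h).1 = (g.1 + h.1)%R :> 'I_4. Proof. by []. Qed.
Lemma mulW2 (g h : W) i : (g * h).2 i = g.2 i * h.2 (i + g.1)%R. Proof. by rewrite ffunE. Qed.

Lemma dih_mul1E (a b : dihedral Zn) : (a * b).1 = a.1 (+) b.1. Proof. by []. Qed.
Lemma dih_mul2E (a b : dihedral Zn) : (a * b).2 = (signr b.1 a.2 + b.2)%R. Proof. by []. Qed.

Lemma twisted_sign_s g i : twisted_sign (gs * g) i = (gs.2 i).1 (+) twisted_sign g i.
Proof.
have gs1 : gs.1 = 0%R :> 'I_4 by apply: val_inj.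
by rewrite /twisted_sign mulW1 mulW2 gs1 add0r addr0 dih_mul1E addbA.
Qed.

(** The correction appears when the rotation wraps from 3 to 0. It is the same for all [i], so it
    cancels in the sum of two signs in [parity_ok]. *)
Lemma twisted_sign_y g i :
  twisted_sign (gy * g) i = twisted_sign g (i + inZp 1)%R (+) (g.1 == inZp 3).
Proof.
rewrite /twisted_sign mulW1 mulW2 dih_mul1E /=.
rewrite -!addbA addbC -!addbA; congr (_ (+) _).
by case: g => r f /=; move: r i; do 2![apply: ord4_ind]; rewrite !ffunE.
Qed.

Lemma parity_ok_s g : parity_ok g -> parity_ok (gs * g).
Proof.
move/forallP => Kg; apply/forallP => i; have /eqP := Kg i.
have gs1 : gs.1 = 0%R :> 'I_4 by apply: val_inj.
rewrite !twisted_sign_s mulW2 dih_mul2E zoddD zodd_signr gs1 addr0 => ->.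
(* The parity condition for [s] itself: sign vector (0, 1, 1, 1), translation (0, 0, 1, 1). *)
have -> : zodd (gs.2 i).2 = (gs.2 (i + inZp 1)%R).1 (+) (gs.2 (i + inZp 2)%R).1.
  by move: i; apply: ord4_ind; rewrite !ffunE /= ?zodd0 // (zodd_nat 1).
by rewrite addbACA.
Qed.

Lemma parity_ok_y g : parity_ok g -> parity_ok (gy * g).
Proof.
move/forallP => Kg; apply/forallP => i; have /eqP := Kg (i + inZp 1)%R.
rewrite !twisted_sign_y mulW2 dih_mul2E zoddD zodd_signr.
have -> : zodd (gy.2 i).2 = false.
  by move: i; apply: ord4_ind; rewrite !ffunE /= zodd0.
rewrite addrAC [(i + _ + inZp 1)%R]addrAC => ->; apply/eqP.
by rewrite addbACA addbb addbF.
Qed.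

Lemma parity_ok1 : parity_ok 1.
Proof. by apply/forallP; apply: ord4_ind; rewrite /twisted_sign !ffunE zodd0. Qed.

Definition rot_group : {group W} := <<[set gx; gy]>>%G.

Lemma rot_group_x : gx \in rot_group. Proof. by rewrite mem_gen ?set21. Qed.
Lemma rot_group_y : gy \in rot_group. Proof. by rewrite mem_gen ?set22. Qed.
Lemma rot_group_s : gs \in rot_group.
Proof. by rewrite -gx_gy groupM ?rot_group_x ?rot_group_y. Qed.

Lemma rot_group_sub_sy : rot_group \subset <<[set gs; gy]>>.
Proof.
rewrite gen_subG subUset !sub1set -{1}[gx](mulgK gy) gx_gy.
by rewrite groupM ?groupV ?mem_gen ?set21 ?set22.
Qed.

Lemma rot_group_mul_parity g k : g \in rot_group -> parity_ok k -> parity_ok (g * k).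
Proof.
move/(subsetP rot_group_sub_sy) => Gg; move: g Gg k.
apply: gen_closed_ind => [k|g h IHg IHh k Kk|g].
- by rewrite mul1g.
- by rewrite -mulgA; apply/IHg/IHh.
by case/set2P => -> k; [apply: parity_ok_s | apply: parity_ok_y].
Qed.

Definition transl (t0 t1 t2 t3 : Zn) : W :=
  wel 0 (d false t0) (d false t1) (d false t2) (d false t3).
Arguments transl (t0 t1 t2 t3)%_R.

Lemma translM t0 t1 t2 t3 u0 u1 u2 u3 :
  transl t0 t1 t2 t3 * transl u0 u1 u2 u3 = transl (t0 + u0) (t1 + u1) (t2 + u2) (t3 + u3).
Proof. by rewrite /transl wel_mul0. Qed.

Lemma translX t0 t1 t2 t3 k :
  transl t0 t1 t2 t3 ^+ k = transl (t0 *+ k) (t1 *+ k) (t2 *+ k) (t3 *+ k).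
Proof.
elim: k => [|k IH]; first by rewrite expg0 wel_one.
by rewrite expgS IH translM -!mulrS.
Qed.

Lemma rot_group_word (w : seq bool) :
  zW (foldr (fun c => zmul (if c then zs else zy)) zone w) \in rot_group.
Proof.
rewrite -zW_prod; last by elim: w => //= -[].
by apply: group_prod => -[] _; [apply: rot_group_s | apply: rot_group_y].
Qed.

Lemma rot_group_wordE (w : seq bool) a :
  foldr (fun c => zmul (if c then zs else zy)) zone w = a -> zW a \in rot_group.
Proof. by move<-; apply: rot_group_word. Qed.

Definition sy_word (ks : seq nat) : seq bool := flatten [seq true :: nseq k false | k <- ks].

(** Each of [e0] to [e3] changes the sign of one coordinate, up to a translation, and its membership
    is certified by an explicit word in [s] and [y]. Their products therefore realise every sign
    pattern. *)
Lemma clear_signs b0 b1 b2 b3 (t0 t1 t2 t3 : Zn) :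
  exists2 h, h \in rot_group & exists u0 u1 u2 u3,
    h * wel 0 (d b0 t0) (d b1 t1) (d b2 t2) (d b3 t3) = transl u0 u1 u2 u3.
Proof.
pose e0 : zword := (0%N, ((true, 0%R), (false, 0%R), (false, (-1)%R), (false, (-1)%R))).
pose e1 : zword := (0%N, ((false, 1%R), (true, 0%R), (false, 0%R), (false, (-1)%R))).
pose e2 : zword := (0%N, ((false, (-1)%R), (false, 1%R), (true, 0%R), (false, 0%R))).
pose e3 : zword := (0%N, ((false, 0%R), (false, 1%R), (false, (-1)%R), (true, 0%R))).
have G0 : zW e0 \in rot_group by apply: (@rot_group_wordE (sy_word [:: 4]%N) e0); vm_compute.
have G1 : zW e1 \in rot_group by apply: (@rot_group_wordE (sy_word [:: 1; 1; 6]%N) e1); vm_compute.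
have G2 : zW e2 \in rot_group by apply: (@rot_group_wordE (sy_word [:: 1; 6; 1]%N) e2); vm_compute.
have G3 : zW e3 \in rot_group by apply: (@rot_group_wordE (sy_word [:: 1; 7; 4]%N) e3); vm_compute.
exists (zW e0 ^+ b0 * (zW e1 ^+ b1 * (zW e2 ^+ b2 * zW e3 ^+ b3))).
  by rewrite !groupM ?groupX.
rewrite -!mulgA /zW /e0 /e1 /e2 /e3 /zD.
by case: b0 b1 b2 b3 {G0 G1 G2 G3} => [] [] [] [];
  rewrite ?expg1 ?expg0 ?mul1g ?wel_mul0 ?dihM; do 4!eexists.
Qed.

(** Even translations are products of powers of the four translations by 2 in one coordinate, each
    the value of an explicit word. *)
Lemma transl_even t0 t1 t2 t3 :
  ~~ zodd t0 -> ~~ zodd t1 -> ~~ zodd t2 -> ~~ zodd t3 -> transl t0 t1 t2 t3 \in rot_group.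
Proof.
have even_half t : ~~ zodd t -> exists k, t = (2%:~R *+ k)%R.
  move=> evt; exists (val t)./2; rewrite -[LHS]natr_Zp -mulrnA.
  by rewrite mul2n -[in LHS](odd_double_half (val t)) -/(zodd t) (negbTE evt).
move=> /even_half[k0 ->] /even_half[k1 ->] /even_half[k2 ->] /even_half[k3 ->].
have -> : transl (2%:~R *+ k0) (2%:~R *+ k1) (2%:~R *+ k2) (2%:~R *+ k3) =
    transl 2%:~R 0 0 0 ^+ k0 * transl 0 2%:~R 0 0 ^+ k1 *
    transl 0 0 2%:~R 0 ^+ k2 * transl 0 0 0 2%:~R ^+ k3.
  by rewrite !translX !translM !mul0rn !addr0 !add0r.
rewrite !groupM ?groupX //.
- by apply: (@rot_group_wordE (sy_word [:: 6; 5; 2; 7]%N) (0%N, ((false, 2%R), (false, 0%R), (false, 0%R), (false, 0%R)))); vm_compute.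
- by apply: (@rot_group_wordE (sy_word [:: 1; 6; 7; 6]%N) (0%N, ((false, 0%R), (false, 2%R), (false, 0%R), (false, 0%R)))); vm_compute.
- by apply: (@rot_group_wordE (sy_word [:: 1; 1; 2; 6; 7; 7]%N) (0%N, ((false, 0%R), (false, 0%R), (false, 2%R), (false, 0%R)))); vm_compute.
by apply: (@rot_group_wordE (sy_word [:: 7; 5; 3; 1]%N) (0%N, ((false, 0%R), (false, 0%R), (false, 0%R), (false, 2%R)))); vm_compute.
Qed.

Lemma gy_exp1 k : (gy ^+ k).1 = inZp k :> 'I_4.
Proof.
elim: k => [|k IH]; first by apply: val_inj.
by rewrite expgS mulW1 IH; apply: val_inj; rewrite /= modnDmr add1n.
Qed.

(** A power of [y] removes the rotation and [clear_signs] removes the signs, both within the group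
    and hence preserving parity. The twisted signs of the translation that remains vanish, so it is
    even. *)
Lemma parity_rot_group g : parity_ok g -> g \in rot_group.
Proof.
move=> Kg; set k := (4 - g.1)%N.
rewrite -(groupMl _ (groupX k rot_group_y)).
have : parity_ok (gy ^+ k * g) by apply: rot_group_mul_parity; rewrite ?groupX ?rot_group_y.
have : (gy ^+ k * g).1 = 0%R :> 'I_4.
  rewrite mulW1 gy_exp1 /k; apply: val_inj; case: (g.1) => r lr /=.
  by rewrite modnDml subnK // ltnW.
move: (gy ^+ k * g) => {k Kg}{}g g1 Kg.
have [r defg] := welP g.
have r0 : r = 0%R by rewrite -g1 defg; apply: val_inj; rewrite /= modn_small.
have [b0 [t0 e0]] := dihP (g.2 (inZp 0)); have [b1 [t1 e1]] := dihP (g.2 (inZp 1)).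
have [b2 [t2 e2]] := dihP (g.2 (inZp 2)); have [b3 [t3 e3]] := dihP (g.2 (inZp 3)).
have [h Gh [u0 [u1 [u2 [u3 hg]]]]] := clear_signs b0 b1 b2 b3 t0 t1 t2 t3.
rewrite -(groupMl _ Gh).
have := rot_group_mul_parity Gh Kg; rewrite defg r0 e0 e1 e2 e3 hg => /forallP Ku.
apply: transl_even.
- by have := Ku (inZp 0); rewrite /twisted_sign !ffunE /= => /eqP->.
- by have := Ku (inZp 1); rewrite /twisted_sign !ffunE /= => /eqP->.
- by have := Ku (inZp 2); rewrite /twisted_sign !ffunE /= => /eqP->.
by have := Ku (inZp 3); rewrite /twisted_sign !ffunE /= => /eqP->.
Qed.

Lemma mem_rot_group g : (g \in rot_group) = parity_ok g.
Proof.
apply/idP/idP => [Gg|]; last exact: parity_rot_group.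
by rewrite -[g]mulg1 rot_group_mul_parity ?parity_ok1.
Qed.

(** The translations by 0/1 vectors; their inverses turn out to represent the 16 right cosets of
    [rot_group]. *)
Definition unit_shift (c : {ffun 'I_4 -> bool}) : W :=
  (0%R, [ffun i => d false (c i)%:R]).

Lemma unit_shift_cover g : exists c, g * unit_shift c \in rot_group.
Proof.
(* The shift acts after the rotation by [g.1], so the parity defect of coordinate [i] of [g] is
   repaired at position [i + g.1]. *)
pose c := [ffun j => zodd (g.2 (j - g.1)%R).2 (+)
  (twisted_sign g (j - g.1 + inZp 1)%R (+) twisted_sign g (j - g.1 + inZp 2)%R)].
exists c; rewrite mem_rot_group; apply/forallP => i; apply/eqP.
have bitM j : twisted_sign (g * unit_shift c) j = twisted_sign g j.
  by rewrite /twisted_sign mulW1 mulW2 ffunE dih_mul1E addbF addr0.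
rewrite !bitM mulW2 !ffunE dih_mul2E zoddD zodd_signr addrK.
rewrite (zodd_nat (_ (+) _)) oddb.
by rewrite addbA addbb.
Qed.

Lemma unit_shift_inj c c' : (unit_shift c)^-1 * unit_shift c' \in rot_group -> c = c'.
Proof.
set u := _ * _; rewrite mem_rot_group => /forallP Ku; apply/ffunP => i.
have eqc : unit_shift c * u = unit_shift c' by rewrite mulKVg.
have u1 : u.1 = 0%R :> 'I_4 by have := congr1 fst eqc; rewrite mulW1 add0r.
have eqi j : d false (c j)%:R * u.2 j = d false (c' j)%:R.
  by have := congr1 (fun g : W => g.2 j) eqc; rewrite mulW2 addr0 !ffunE.
have bit0 j : twisted_sign u j = false.
  have [b [t ut]] := dihP (u.2 j); have := eqi j.
  rewrite /twisted_sign u1 ut dihM => /(congr1 fst)/= ->.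
  by rewrite leqNgt ltn_ord.
have := congr1 (fun e : dihedral Zn => zodd e.2) (eqi i).
rewrite dih_mul2E zoddD zodd_signr !zodd_nat !oddb.
by have /eqP-> := Ku i; rewrite !bit0 !addbF.
Qed.

(** The 2^4 unit shifts give the index in the wreath product, whose order is 4 * (16m)^4 = 2^18
    m^4. *)
Lemma card_rot_group : #|rot_group| = (2 ^ 14 * m ^ 4)%N.
Proof.
pose f (gc : W * {ffun 'I_4 -> bool}) := gc.1 * (unit_shift gc.2)^-1.
have injf : {in setX rot_group [set: {ffun 'I_4 -> bool}] &, injective f}.
  move=> [g c] [g' c'] /setXP[/= Gg _] /setXP[/= Gg' _]; rewrite /f /= => eqf.
  have eqc : c = c'.
    apply: unit_shift_inj.
    have -> : (unit_shift c)^-1 * unit_shift c' = g^-1 * g'.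
      by apply: (mulgI g); rewrite mulKVg mulgA eqf mulgKV.
    by rewrite groupM ?groupV.
  by move: eqf; rewrite eqc => /mulIg->.
have surf : f @: setX rot_group [set: {ffun 'I_4 -> bool}] = [set: W].
  apply/setP => g; rewrite inE; have [c Gc] := unit_shift_cover g.
  by apply/imsetP; exists (g * unit_shift c, c); rewrite ?in_setX ?inE ?Gc // /f mulgK.
have := card_in_imset injf; rewrite surf cardsX !cardsT card_prod.
rewrite !card_ffun card_prod !card_bool !card_ord -[X in (2 * X)%N]card_ord card_Zn.
have -> : (4 * (2 * n) ^ 4 = (2 ^ 14 * m ^ 4) * 2 ^ 4)%N.
  rewrite mulnA -[(2 * 8)%N]/(2 ^ 4)%N expnMn -expnM -[X in (X * _)%N = _]/(2 ^ 2)%N.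
  by rewrite mulnA [RHS]mulnAC -!expnD.
by move/eqP; rewrite eqn_pmul2r // eq_sym => /eqP.
Qed.

(* Applied to additive maps killed one after the other, this shows that every perfect
   subgroup is trivial. *)
Lemma perfect_kernel (gT : finGroupType) (H : {group gT}) (V : zmodType) (f : gT -> V) :
    {in H &, forall g h, f (g * h) = (f g + f h)%R} -> H \subset [~: H, H] ->
  {in H, forall g, f g = 0%R}.
Proof.
move=> fM perfH.
have f1 : f 1 = 0%R by apply: (addrI (f 1)); rewrite -fM ?group1 // mulg1 addr0.
have fV g : g \in H -> f g^-1 = (- f g)%R.
  by move=> Hg; apply/eqP; rewrite -addr_eq0 -fM ?groupV // mulVg f1.
suff comm g : g \in [~: H, H] -> g \in H /\ f g = 0%R.
  by move=> g /(subsetP perfH)/comm[].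
move: g; apply: gen_closed_ind => [|g h [Hg fg] [Hh fh]|g].
- by rewrite group1.
- by rewrite groupM // fM // fg fh addr0.
case/imset2P=> a b Ha Hb ->; rewrite groupR // /commg conjgE.
by rewrite !fM ?groupM ?groupV // !fV // [(f a + _)%R]addrC addKr addNr.
Qed.

(** On a perfect subgroup the rotation is additive and vanishes; then the signs become additive, and
    after them the translation parts. *)
Lemma solvable_W : solvable [set: W].
Proof.
apply/forallP => H; apply/implyP; rewrite setTI => perfH.
have H1 : {in H, forall g : W, g.1 = 0%R :> 'I_4}.
  by apply: perfect_kernel perfH => g h _ _; rewrite mulW1.
(* Signs are valued in ['Z_2] so that exclusive or becomes addition. *)
pose sgn (i : 'I_4) (g : W) : 'Z_2 := ((g.2 i).1 : nat)%:R%R.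
have H2 (i : 'I_4) : {in H, forall g : W, (g.2 i).1 = false}.
  have H2' : {in H, forall g, sgn i g = 0%R}.
    apply: perfect_kernel perfH => g h Hg _; rewrite /sgn mulW2 H1 // addr0 dih_mul1E.
    by case: (g.2 i).1; case: (h.2 i).1; apply: val_inj.
  by move=> g /H2'; rewrite /sgn; case: (g.2 i).1.
have H3 (i : 'I_4) : {in H, forall g : W, (g.2 i).2 = 0%R}.
  apply: perfect_kernel perfH => g h Hg Hh; rewrite mulW2 H1 // addr0 dih_mul2E.
  by rewrite H2.
apply/eqP/trivgP/subsetP => g Hg; rewrite inE; apply/eqP.
rewrite -[1]/(0%R, [ffun => 1]) [g]surjective_pairing H1 //; congr (_, _).
apply/ffunP => i; rewrite ffunE [g.2 i]surjective_pairing H2 // H3 //.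
Qed.

(** * Quotients by binary codes *)

Definition half_turn (b : bool) : Zn := (if b then (4 * m)%:R else 0)%R.

Lemma halfD a b : (half_turn a + half_turn b)%R = half_turn (a (+) b).
Proof.
case: a b => [] []; rewrite /half_turn /= ?addr0 ?add0r // -natrD -mulnDl.
by apply: val_inj; rewrite /= val_Zp_nat ?n_gt1 // modnn.
Qed.

(** As 8m = 0, the residue 4m is its own negative. Sign changes therefore fix the code translations,
    and only the shift of coordinates by [y] acts on codewords. *)
Lemma halfN b : (- half_turn b)%R = half_turn b.
Proof. by apply/eqP; rewrite eq_sym -addr_eq0 halfD addbb. Qed.

Lemma zodd_half b : zodd (half_turn b) = false.
Proof. by case: b; rewrite /half_turn ?zodd0 // zodd_nat oddM. Qed.

Lemma half_inj : injective half_turn.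
Proof.
have nz : (half_turn true == half_turn false) = false.
  rewrite /half_turn; apply/negP => /eqP/(congr1 (fun t : Zn => val t)) /=.
  rewrite val_Zp_nat ?n_gt1 // modn_small.
    by move/eqP; rewrite muln_eq0 /= eqn0Ngt m_gt0.
  by rewrite ltn_pmul2r.
move=> [] [] // /eqP; first by rewrite nz.
by rewrite eq_sym nz.
Qed.

(** The residue 4m is a multiple of 4 and 2 is not. This keeps the mirrored word, whose first
    coordinate is 2, outside every code subgroup. *)
Lemma half_neq2 b : half_turn b != 2%:~R%R.
Proof.
have two : nat_of_ord (2%:R%R : Zn) = 2.
  by rewrite val_Zp_nat ?n_gt1 // modn_small // -(prednK m_gt0) mulnS.
rewrite -[2%:~R%R]/(2%:R%R : Zn).
apply/eqP => /(congr1 (fun t : Zn => nat_of_ord t)); rewrite two /half_turn; case: b => //=.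
rewrite val_Zp_nat ?n_gt1 // modn_small ?ltn_pmul2r // => /(congr1 (fun k => 4 %| k)).
by rewrite dvdn_mulr.
Qed.

Definition code_transl (c : codeword) : W :=
  let: (c0, c1, c2, c3) := c in transl (half_turn c0) (half_turn c1) (half_turn c2) (half_turn c3).

Definition xor_codeword (c e : codeword) : codeword :=
  let: (c0, c1, c2, c3) := c in let: (e0, e1, e2, e3) := e in
  (c0 (+) e0, c1 (+) e1, c2 (+) e2, c3 (+) e3).

Definition rot_codeword (c : codeword) : codeword := let: (c0, c1, c2, c3) := c in (c3, c0, c1, c2).

Lemma code_translM c e : code_transl c * code_transl e = code_transl (xor_codeword c e).
Proof.
by case: c e => [[[c0 c1] c2] c3] [[[e0 e1] e2] e3]; rewrite /code_transl translM !halfD.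
Qed.

Lemma code_transl_inj : injective code_transl.
Proof.
move=> [[[c0 c1] c2] c3] [[[e0 e1] e2] e3] /eqP; rewrite wel_eq !dih_eq /=.
by case/and4P=> /eqP/half_inj-> /eqP/half_inj-> /eqP/half_inj-> /eqP/half_inj->.
Qed.

Lemma code_transl_s c : code_transl c * gs = gs * code_transl c.
Proof.
case: c => [[[c0 c1] c2] c3]; rewrite /code_transl /transl /zW /zD /= !wel_mul0 !dihM /= !halfN.
by rewrite ?addbF /signr /= ![(half_turn _ + _)%R]addrC.
Qed.

Lemma code_transl_y c : code_transl c * gy = gy * code_transl (rot_codeword c).
Proof.
case: c => [[[c0 c1] c2] c3]; rewrite /code_transl /transl /zW /zD /=.
rewrite !wel_mul0 wel_mul1 !dihM /= !halfN.
by rewrite ?addbF /signr /= ![(half_turn _ + _)%R]addrC.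
Qed.

Lemma code_transl_rot_group c : code_transl c \in rot_group.
Proof. by case: c => [[[c0 c1] c2] c3]; apply: transl_even; rewrite zodd_half. Qed.

Definition is_transl (a : zword) : bool :=
  let: (r, (a0, a1, a2, a3)) := a in [&& r == 0%N, ~~ a0.1, ~~ a1.1, ~~ a2.1 & ~~ a3.1].

Lemma zW_is_transl a t0 t1 t2 t3 : a.1 < 4 -> zW a = transl t0 t1 t2 t3 -> is_transl a.
Proof.
case: a => r [[[a0 a1] a2] a3] /= lt4 /eqP.
rewrite wel_eq /zD !dih_eq (modn_small lt4) mod0n => /and5P[-> /andP[/eqP-> _] /andP[/eqP-> _]].
by move=> /andP[/eqP-> _] /andP[/eqP-> _].
Qed.

(** The orders of [x] and [y] leave 32 pairs of exponents. [is_transl] inspects only the linear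
    part, so one computation settles them for all [m]. *)
Lemma xy_exp_transl i j t0 t1 t2 t3 :
  gx ^+ i * gy ^+ j = transl t0 t1 t2 t3 -> (4 %| i) && (8 %| j).
Proof.
rewrite -(expg_mod i gx4) -(expg_mod j gy8) !zW_exp // -zW_mul; last first.
  by case: (i %% 4)%N => [//|k]; apply: zmul_lt4.
pose f a b := is_transl (zmul (iter a (zmul zx) zone) (iter b (zmul zy) zone)) ==>
  (a == 0%N) && (b == 0%N).
have /allP fP : all (fun a => all (f a) (iota 0 8)) (iota 0 4) by vm_compute.
have /fP/allP fPi : (i %% 4)%N \in iota 0 4 by rewrite mem_iota ltn_mod.
have /fPi : (j %% 8)%N \in iota 0 8 by rewrite mem_iota ltn_mod.
by move=> /implyP H /zW_is_transl E; apply/H/E/zmul_lt4.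
Qed.

(** Closure under sums makes the code translations a subgroup. It is normal because [s] centralises
    it and [y] shifts its codewords cyclically. *)
Lemma chiral_4_8 (C : {pred codeword}) :
    (false, false, false, false) \in C ->
    (forall c e, c \in C -> e \in C -> xor_codeword c e \in C) ->
    (forall c, c \in C -> rot_codeword c \in C) ->
  exists P : polytope 3, [/\ chiral P, has_type P [:: 4; 8]%N, solvable (polytope_aut P)
    & (#|polytope_aut P| * #|C| = 2 ^ 14 * m ^ 4)%N].
Proof.
move=> C0 CM Crot; pose N := [set code_transl c | c in C].
have gN : group_set N.
  apply/group_setP; split=> [|_ _ /imsetP[c Cc ->] /imsetP[e Ce ->]].
    by apply/imsetP; exists (false, false, false, false); rewrite // wel_one.
  by apply/imsetP; exists (xor_codeword c e); rewrite ?code_translM ?CM.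
have nsNG : Group gN <| rot_group.
  apply/andP; split.
    by apply/subsetP => _ /imsetP[c _ ->]; apply: code_transl_rot_group.
  apply: subset_trans rot_group_sub_sy _; rewrite gen_subG subUset !sub1set !inE.
  apply/andP; split; apply/subsetP => _ /imsetP[_ /imsetP[c Cc ->] ->]; apply/imsetP.
    by exists c; rewrite // conjgE code_transl_s mulKg.
  by exists (rot_codeword c); rewrite ?Crot // conjgE code_transl_y mulKg.
have xy2 : (gx * gy) ^+ 2 = 1 by rewrite gx_gy gs2.
have tiN i j : gx ^+ i * gy ^+ j \in Group gN -> (4 %| i) && (8 %| j).
  by move=> /imsetP[[[[c0 c1] c2] c3] _] /xy_exp_transl.
have solG : solvable rot_group := solvableS (subsetT rot_group) solvable_W.
have wN : \prod_(c <- chiral_word) (if c then gx * gy else gy^-1) \notin Group gN.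
  rewrite chiral_word_mirror; apply/imsetP => -[[[[c0 c1] c2] c3] _] /eqP.
  by rewrite wel_eq !dih_eq /= eq_sym (negbTE (half_neq2 c0)).
have [P [chP tP solP cardP]] := chiral_polytope_of_quotient (isT : 1 < 4) (isT : 1 < 8)
  xy2 gx4 gy8 tiN erefl nsNG solG chiral_word_eq1 wN.
exists P; split=> //; rewrite -card_rot_group -cardP; congr (_ * _)%N.
by rewrite card_imset //; apply: code_transl_inj.
Qed.

End Lattice.

Local Close Scope group_scope.

(** * The four codes *)

Lemma card_code (C : pred codeword) :
  #|C| = \sum_(a : bool) \sum_(b : bool) \sum_(c : bool) \sum_(d : bool) C (a, b, c, d).
Proof.
by rewrite -sum1_card big_mkcond 3!pair_bigA /=; apply: eq_bigr => -[[[a b] c] d].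
Qed.

Lemma chiral_4_8_index m (m_gt0 : 0 < m) (j k : nat) (C : pred codeword) :
    (false, false, false, false) \in C ->
    (forall c e, c \in C -> e \in C -> xor_codeword c e \in C) ->
    (forall c, c \in C -> rot_codeword c \in C) ->
    #|C| = 2 ^ k -> (j + k = 14)%N ->
  exists P : polytope 3, [/\ chiral P, has_type P [:: 4; 8], solvable (polytope_aut P)
    & #|polytope_aut P| = (2 ^ j * m ^ 4)%N].
Proof.
move=> C0 CM Crot cardC jk; have [P [chP tP solP]] := chiral_4_8 m_gt0 C0 CM Crot.
rewrite cardC -jk expnD mulnAC => /eqP; rewrite eqn_pmul2r ?expn_gt0 // => /eqP cardP.
by exists P.
Qed.

Theorem theorem1p4 (m : nat) (m_gt0 : (0 < m)%N) :
  exists P1 P2 P3 P4 : polytope 3,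
    [/\ [/\ chiral P1, has_type P1 [:: 4; 8], solvable (polytope_aut P1) &
            #|polytope_aut P1| = (2 ^ 10 * m ^ 4)%N],
        [/\ chiral P2, has_type P2 [:: 4; 8], solvable (polytope_aut P2) &
            #|polytope_aut P2| = (2 ^ 11 * m ^ 4)%N],
        [/\ chiral P3, has_type P3 [:: 4; 8], solvable (polytope_aut P3) &
            #|polytope_aut P3| = (2 ^ 12 * m ^ 4)%N] &
        [/\ chiral P4, has_type P4 [:: 4; 8], solvable (polytope_aut P4) &
            #|polytope_aut P4| = (2 ^ 13 * m ^ 4)%N]].
Proof.
(* These are the ideals generated by (1 + X)^k in F_2[X]/(X^4 + 1) for k = 0, 1, 2, 3: all words,
   the even-weight words, the words of period 2, and the repetition code. Their sizes 16, 8, 4, 2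
   divide 2^14 m^4 to give the four orders. *)
pose C1 : pred codeword := predT.
pose C2 : pred codeword := fun c => let: (c0, c1, c2, c3) := c in ~~ (c0 (+) c1 (+) c2 (+) c3).
pose C3 : pred codeword := fun c => let: (c0, c1, c2, c3) := c in (c0 == c2) && (c1 == c3).
pose C4 : pred codeword :=
  fun c => let: (c0, c1, c2, c3) := c in [&& c0 == c1, c1 == c2 & c2 == c3].
have [P1 HP1] : exists P : polytope 3, [/\ chiral P, has_type P [:: 4; 8],
    solvable (polytope_aut P) & #|polytope_aut P| = (2 ^ 10 * m ^ 4)%N].
  apply: (@chiral_4_8_index _ m_gt0 10 4 C1) => //.
  by rewrite card_code !big_bool.
have [P2 HP2] : exists P : polytope 3, [/\ chiral P, has_type P [:: 4; 8],
    solvable (polytope_aut P) & #|polytope_aut P| = (2 ^ 11 * m ^ 4)%N].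
  apply: (@chiral_4_8_index _ m_gt0 11 3 C2) => //.
  - by move=> [[[[] []] []] []] [[[[] []] []] []].
  - by move=> [[[[] []] []] []].
  by rewrite card_code !big_bool.
have [P3 HP3] : exists P : polytope 3, [/\ chiral P, has_type P [:: 4; 8],
    solvable (polytope_aut P) & #|polytope_aut P| = (2 ^ 12 * m ^ 4)%N].
  apply: (@chiral_4_8_index _ m_gt0 12 2 C3) => //.
  - by move=> [[[[] []] []] []] [[[[] []] []] []].
  - by move=> [[[[] []] []] []].
  by rewrite card_code !big_bool.
have [P4 HP4] : exists P : polytope 3, [/\ chiral P, has_type P [:: 4; 8],
    solvable (polytope_aut P) & #|polytope_aut P| = (2 ^ 13 * m ^ 4)%N].
  apply: (@chiral_4_8_index _ m_gt0 13 1 C4) => //.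
  - by move=> [[[[] []] []] []] [[[[] []] []] []].
  - by move=> [[[[] []] []] []].
  by rewrite card_code !big_bool.
by exists P1, P2, P3, P4.
Qed.
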